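(* There exist infinitely many quadratic fields $\mathbb{K}$ such that for each of them there exist infinitely many Diophantine triples over $\mathbb{K}$ whose induced elliptic curves have torsion group $E(\mathbb{K})_{\mathrm{tors}}\cong \mathbb{Z}/2\mathbb{Z}\times\mathbb{Z}/10\mathbb{Z}$.
   Context: For a field $\mathbb{K}$, a Diophantine triple over $\mathbb{K}$ is a set $\{a,b,c\}$ of three distinct nonzero elements of $\mathbb{K}$ such that $ab+1$, $ac+1$ and $bc+1$ are all squares in $\mathbb{K}$. The elliptic curve induced by the Diophantine triple $\{a,b,c\}$ is $E:\ y^2=(ax+1)(bx+1)(cx+1)$ over $\mathbb{K}$. A quadratic field is a field extension of $\mathbb{Q}$ of degree $2$. *)

(* Defs.v *)
(* Quadratic fields are realized as subfields of algC
   (the algebraic closure of Q), which contains a copy of every number field. *)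
From mathcomp Require Import all_boot all_order all_algebra all_field.
Set Implicit Arguments. Unset Strict Implicit. Unset Printing Implicit Defensive.
Import Order.TTheory GRing.Theory Num.Theory.
Local Open Scope ring_scope.

Definition is_subfield (K : algC -> Prop) : Prop :=
  K 1 /\
  (forall x y, K x -> K y -> K (x - y)) /\
  (forall x y, K x -> K y -> K (x * y)) /\
  (forall x, K x -> x != 0 -> K x^-1).

Definition Qdim2 (K : algC -> Prop) : Prop :=
  exists w1 w2 : algC, K w1 /\ K w2 /\
    (forall p q : rat, ratr p * w1 + ratr q * w2 = 0 -> p = 0 /\ q = 0) /\
    (forall x, K x -> exists p q : rat, x = ratr p * w1 + ratr q * w2).

Definition quadratic_field (K : algC -> Prop) : Prop :=
  is_subfield K /\ Qdim2 K.

Definition is_square_in (K : algC -> Prop) (x : algC) : Prop :=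
  exists r, K r /\ x = r ^+ 2.

Definition dioph_triple (K : algC -> Prop) (a b c : algC) : Prop :=
  [/\ K a, K b & K c] /\
  [/\ a != 0, b != 0 & c != 0] /\
  [/\ a != b, a != c & b != c] /\
  [/\ is_square_in K (a * b + 1), is_square_in K (a * c + 1)
    & is_square_in K (b * c + 1)].

(* Points of the projective curve E : y^2 = (ax+1)(bx+1)(cx+1);
   None is the point at infinity O (the neutral element). *)
Definition ecpt := option (algC * algC).

Definition ec_f (a b c x : algC) : algC := (a * x + 1) * (b * x + 1) * (c * x + 1).

Definition ec_df (a b c x : algC) : algC :=
  a * (b * x + 1) * (c * x + 1) + (a * x + 1) * b * (c * x + 1)
  + (a * x + 1) * (b * x + 1) * c.

Definition on_curve (a b c : algC) (P : ecpt) : Prop :=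
  match P with None => True | Some (x, y) => y ^+ 2 = ec_f a b c x end.

Definition ec_point_in (K : algC -> Prop) (a b c : algC) (P : ecpt) : Prop :=
  on_curve a b c P /\
  match P with None => True | Some (x, y) => K x /\ K y end.

(* The chord-tangent group law on E (cubic with leading coefficient abc and
   x^2-coefficient ab+ac+bc), with neutral element O = None. *)
Definition ec_add (a b c : algC) (P Q : ecpt) : ecpt :=
  match P, Q with
  | None, _ => Q
  | _, None => P
  | Some (x1, y1), Some (x2, y2) =>
    if (x1 == x2) && (y1 == - y2) then None
    else
      let l := if x1 == x2 then ec_df a b c x1 / (2 * y1)
               else (y2 - y1) / (x2 - x1) in
      let x3 := (l ^+ 2 - (a * b + a * c + b * c)) / (a * b * c) - x1 - x2 in
      Some (x3, - (l * (x3 - x1) + y1))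
  end.

Definition ec_mul (a b c : algC) (n : nat) (P : ecpt) : ecpt :=
  iter n (ec_add a b c P) None.

Definition ec_torsion (K : algC -> Prop) (a b c : algC) (P : ecpt) : Prop :=
  ec_point_in K a b c P /\ exists n : nat, (0 < n)%N /\ ec_mul a b c n P = None.

Definition torsion_Z2xZ10 (K : algC -> Prop) (a b c : algC) : Prop :=
  exists phi : 'Z_2 * 'Z_10 -> ecpt,
    injective phi /\
    (forall u v, phi (u + v) = ec_add a b c (phi u) (phi v)) /\
    (forall P, ec_torsion K a b c P <-> exists u, phi u = P).

(* Main.v *)
(* If kappa^2 = W and zeta^2 = 1 + W - W^2 with W, zeta rational, then the triple
   [triple_of kappa W zeta] over K = Q(kappa) satisfies two algebraic relations:
   one makes it a regular Diophantine triple, the other makes (0, 1) a point of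
   order 5; as the 2-torsion is rational by construction, E(K) contains
   Z/2 x Z/10.  To see that there is no further torsion, impose W = 2 modulo 5.
   Then 5 is inert in K, E has good reduction at 5 with exactly 20 points over
   F_25, and torsion injects into the reduction because in the formal group at 5
   the parameter z = x / y of n P is n z up to terms of three times the valuation
   of z.  Tripling a point on the genus one curve zeta^2 = 1 + W - W^2 (twisted by
   W) replaces W by W rho^2, so it keeps the field; it also keeps W modulo 5, and
   it raises the 3-adic valuation of W by 2, which gives infinitely many triples
   over each field.  The starting points W = n (n + 2) / (n^2 + 1), with n divisible
   exactly once by a new prime, give infinitely many fields. *)
Require Import Defs.
From mathcomp Require Import all_boot all_order all_algebra all_field.
From HB Require Import structures.
From mathcomp Require Import ring zify.
Set Implicit Arguments. Unset Strict Implicit. Unset Printing Implicit Defensive.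
Import Order.TTheory GRing.Theory Num.Theory.
Local Open Scope ring_scope.

(** Origin of the coefficients: if P = (0, 1) has order 5, then P = 2 (3 P), and 2-descent on Y^2 =
    (X + bc)(X + ac)(X + ab) makes bc a square s^2. With bc + 1 = r^2 this leaves r^2 - s^2 = 1,
    parametrised by kappa = r - s: s = (1 - W) / (2 kappa) and r = (1 + W) / (2 kappa). Regularity
    in the form a = b + c - 2 r turns the order 5 relation into (s (2 a r + 1))^2 = r^2, and one
    choice of sign gives a = (r - s) / (2 r s) = 2 W kappa / (1 - W^2). Then b and c are the roots
    of X^2 - (a + 2 r) X + s^2, with discriminant 4 (1 + W - W^2) / (1 - W^2)^2. The congruences W =
    zeta = 2 modulo 5 are compatible with zeta^2 = 1 + W - W^2 and fix the residues of a, b and c,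
    so one finite count of points serves every triple. The torsion bound is an argument about
    differences and multiples of points, so the chord-tangent formulas must first be shown to be
    associative; this is done for any smooth cubic with a leading coefficient k, the form in which
    the induced curves appear. *)

Section LinearCombinations.
Variable R : zmodType.
Implicit Types x y a b c d : R.

Lemma eq_from_sub x y a b : a = b -> x - y = a - b -> x = y.
Proof. by move=> -> /eqP; rewrite subrr subr_eq0 => /eqP. Qed.

Lemma eq_add a b c d : a = b -> c = d -> a + c = b + d.
Proof. by move=> -> ->. Qed.
End LinearCombinations.

Lemma eq_scale (R : pzSemiRingType) (c a b : R) : a = b -> c * a = c * b.
Proof. by move=> ->. Qed.

Notation "e1 +e e2" := (eq_add e1 e2) (at level 50, left associativity, only parsing).
Notation "c *e e" := (eq_scale c e) (at level 40, only parsing).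

(* [lincomb (c1 *e h1 +e c2 *e h2)], for hi : li = ri, proves x = y when
   x - y = c1 (l1 - r1) + c2 (l2 - r2) is a ring identity. *)
Tactic Notation "lincomb" uconstr(e) := refine (eq_from_sub e _); ring.

(** * The group law on y^2 = k x^3 + A x^2 + B x + C *)

Section Cubic.
Variables (F : fieldType) (k A B C : F).

Definition cub x := k * x ^+ 3 + A * x ^+ 2 + B * x + C.
Definition dcub x := 3 * k * x ^+ 2 + 2 * A * x + B.

Definition pt := option (F * F).
Implicit Types P Q R : pt.

Definition oncurve P : bool :=
  if P is Some (x, y) then y ^+ 2 == cub x else true.

Definition popp P : pt := if P is Some (x, y) then Some (x, - y) else None.

Definition padd P Q : pt :=
  match P, Q with
  | None, _ => Q
  | _, None => P
  | Some (x1, y1), Some (x2, y2) =>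
    if (x1 == x2) && (y1 == - y2) then None
    else
      let l := if x1 == x2 then dcub x1 / (2 * y1)
               else (y2 - y1) / (x2 - x1) in
      let x3 := (l ^+ 2 - A) / k - x1 - x2 in
      Some (x3, - (l * (x3 - x1) + y1))
  end.

(* The line y = l x + m meets the cubic in the three given points, counted
   with multiplicity: cub X - (l X + m)^2 = k (X - x1) (X - x2) (X - x3). *)
Definition col_on (l m x1 y1 x2 y2 x3 y3 : F) : Prop :=
  [/\ y1 = l * x1 + m, y2 = l * x2 + m & y3 = l * x3 + m] /\
  [/\ l ^+ 2 = A + k * (x1 + x2 + x3),
      2 * (l * m) = B - k * (x1 * x2 + x1 * x3 + x2 * x3)
    & m ^+ 2 = C + k * (x1 * x2 * x3)].

Lemma col_on12 l m x1 y1 x2 y2 x3 y3 :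
  col_on l m x1 y1 x2 y2 x3 y3 -> col_on l m x2 y2 x1 y1 x3 y3.
Proof.
by move=> [[-> -> ->] [e2 e1 e0]]; split; split=> //; rewrite ?(e2, e1, e0); ring.
Qed.

Lemma col_on23 l m x1 y1 x2 y2 x3 y3 :
  col_on l m x1 y1 x2 y2 x3 y3 -> col_on l m x1 y1 x3 y3 x2 y2.
Proof.
by move=> [[-> -> ->] [e2 e1 e0]]; split; split=> //; rewrite ?(e2, e1, e0); ring.
Qed.

Lemma col_onN l m x1 y1 x2 y2 x3 y3 :
  col_on l m x1 y1 x2 y2 x3 y3 -> col_on (- l) (- m) x1 (- y1) x2 (- y2) x3 (- y3).
Proof.
move=> [[-> -> ->] [e2 e1 e0]]; split; split; try ring.
- by rewrite sqrrN.
- by rewrite mulrNN.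
- by rewrite sqrrN.
Qed.

Lemma col_on_curve l m x1 y1 x2 y2 x3 y3 :
  col_on l m x1 y1 x2 y2 x3 y3 -> y1 ^+ 2 = cub x1.
Proof.
by move=> [[-> _ _] [e2 e1 e0]]; rewrite /cub; lincomb (x1 ^+ 2 *e e2 +e x1 *e e1 +e e0).
Qed.

Hypotheses (two_neq0 : 2 != 0 :> F) (k_neq0 : k != 0).
Hypothesis smooth : forall x, cub x = 0 -> dcub x != 0.

Lemma padd_col_on l m x1 y1 x2 y2 x3 y3 :
  col_on l m x1 y1 x2 y2 x3 y3 ->
  padd (Some (x1, y1)) (Some (x2, y2)) = Some (x3, - y3).
Proof.
move=> cP; have onP := col_on_curve cP.
case: cP => [[y1E y2E y3E] [e2 e1 e0]].
have slopeE : x1 = x2 -> dcub x1 = 2 * y1 * l.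
  by move=> x12; subst x2; rewrite /dcub y1E; lincomb (- (1) *e e1 +e (-2 * x1) *e e2).
(* A nonvertical line through a point and its opposite forces y1 = 0, and then the cubic has a
   double root at x1, against smoothness. *)
rewrite /padd; case: ifP => [/andP[/eqP x12 /eqP y12]|].
  have y10 : y1 = 0.
    apply/eqP; rewrite -(mulrI_eq0 _ (mulfI two_neq0)); apply/eqP.
    rewrite mulr_natl mulr2n {2}y12 y2E -x12 -y1E subrr //.
  have := smooth (x := x1); rewrite -onP y10 expr0n slopeE // y10.
  by move/(_ erefl)/eqP; rewrite mulr0 mul0r.
move=> nopp.
have -> : (if x1 == x2 then dcub x1 / (2 * y1) else (y2 - y1) / (x2 - x1)) = l.
  case: eqP => [x12|/eqP x12].
    rewrite slopeE // mulrC mulKf // mulf_neq0 //.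
    apply: contraFN nopp => /eqP y10; rewrite x12 eqxx.
    by rewrite y10 y2E -x12 -y1E y10 oppr0 eqxx.
  rewrite y1E y2E (_ : _ - _ = l * (x2 - x1)); last ring.
  by rewrite mulfK // subr_eq0 eq_sym.
have -> : (l ^+ 2 - A) / k - x1 - x2 = x3 by rewrite e2; field.
by rewrite y1E y3E; congr (Some (_, _)); ring.
Qed.

Lemma col_on_ex x1 y1 x2 y2 :
  oncurve (Some (x1, y1)) -> oncurve (Some (x2, y2)) ->
  ~~ ((x1 == x2) && (y1 == - y2)) ->
  exists l m x3 y3, col_on l m x1 y1 x2 y2 x3 y3.
Proof.
rewrite /oncurve /cub => /eqP on1 /eqP on2 nopp.
have [x12|x12] := eqVneq x1 x2.
  subst x2; have : (y1 - y2) * (y1 + y2) = 0.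
    by rewrite -subr_sqr on1 on2 subrr.
  move/eqP; rewrite mulf_eq0 subr_eq0 addr_eq0.
  move: (nopp); rewrite eqxx /= => /negPf->; rewrite orbF => /eqP y12; subst y2.
  move: nopp; rewrite eqxx /= -addr_eq0 -mulr2n -mulr_natl mulf_eq0.
  rewrite (negPf two_neq0) /= => y10.
  pose l := dcub x1 / (2 * y1); pose m := y1 - l * x1.
  pose x3 := (l ^+ 2 - A) / k - x1 - x1.
  have e2 : l ^+ 2 = A + k * (x1 + x1 + x3) by rewrite /x3; field.
  have el : 2 * y1 * l = 3 * k * x1 ^+ 2 + 2 * A * x1 + B.
    by rewrite /l /dcub; field; rewrite y10.
  exists l, m, x3, (l * x3 + m); split; split=> //; rewrite /m; try ring.
  - lincomb ((- 2 * x1) *e e2 +e el).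
  - lincomb (on1 +e (- x1) *e el +e x1 ^+ 2 *e e2).
have x12' : x2 - x1 != 0 by rewrite subr_eq0 eq_sym.
pose l := (y2 - y1) / (x2 - x1); pose m := y1 - l * x1.
pose x3 := (l ^+ 2 - A) / k - x1 - x2.
have e2 : l ^+ 2 = A + k * (x1 + x2 + x3) by rewrite /x3; field.
have el : y2 = y1 + l * (x2 - x1) by rewrite /l; field.
exists l, m, x3, (l * x3 + m).
have e1 : 2 * (l * m) = B - k * (x1 * x2 + x1 * x3 + x2 * x3).
  apply: (mulfI x12'); rewrite /m.
  move: on2; rewrite el => on2.
  lincomb (on2 +e - (1) *e on1 +e (- (x2 - x1) * (x1 + x2)) *e e2).
rewrite /m in e1 *; split; split=> //; rewrite ?el; try ring.
lincomb (on1 +e (- x1) *e e1 +e (- x1 ^+ 2) *e e2).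
Qed.


Lemma paddC P Q : oncurve P -> oncurve Q -> padd P Q = padd Q P.
Proof.
case: P Q => [[x1 y1]|] [[x2 y2]|] // on1 on2.
have [/andP[/eqP-> /eqP->]|nopp] := boolP ((x1 == x2) && (y1 == - y2)).
  by rewrite /padd opprK !eqxx.
have [l [m [x3 [y3 cP]]]] := col_on_ex on1 on2 nopp.
by rewrite (padd_col_on cP) (padd_col_on (col_on12 cP)).
Qed.

Lemma oncurve_opp P : oncurve (popp P) = oncurve P.
Proof. by case: P => [[x y]|] //=; rewrite sqrrN. Qed.

Lemma poppK : involutive popp.
Proof. by case=> [[x y]|] //=; rewrite opprK. Qed.

Lemma paddN P : padd (popp P) P = None.
Proof. by case: P => [[x y]|] //=; rewrite !eqxx. Qed.

(** Separates the trivial sums from those computed by a genuine line, so that the group identities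
    reduce to symmetries of [col_on]. *)
Lemma popp_split P Q : oncurve P -> oncurve Q ->
  [\/ P = None, Q = None, Q = popp P | exists l m x1 y1 x2 y2 x3 y3,
    [/\ P = Some (x1, y1), Q = Some (x2, y2), padd P Q = Some (x3, - y3)
      & col_on l m x1 y1 x2 y2 x3 y3]].
Proof.
case: P Q => [[x1 y1]|] [[x2 y2]|] on1 on2;
  [| by constructor 2 | by constructor 1 | by constructor 1].
have [/andP[/eqP-> /eqP->]|nopp] := boolP ((x1 == x2) && (y1 == - y2)).
  by constructor 3; rewrite /= opprK.
have [l [m [x3 [y3 cP]]]] := col_on_ex on1 on2 nopp.
by constructor 4; exists l, m, x1, y1, x2, y2, x3, y3; rewrite (padd_col_on cP).
Qed.

Lemma oncurve_add P Q : oncurve P -> oncurve Q -> oncurve (padd P Q).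
Proof.
move=> onP onQ; case: (popp_split onP onQ) => [->|->|->|] //.
- by case: P onP => [[]|].
- by rewrite -{1}[P]poppK paddN.
move=> [l [m [x1 [y1 [x2 [y2 [x3 [y3 [_ _ -> cP]]]]]]]]] /=.
by rewrite sqrrN; apply/eqP/(col_on_curve (col_on12 (col_on23 cP))).
Qed.

(** If a line meets the curve in P, Q, S, the reflected line meets it in -P, -S = P + Q and -Q. *)
Lemma paddK P Q : oncurve P -> oncurve Q -> padd (popp P) (padd P Q) = Q.
Proof.
move=> onP onQ; case: (popp_split onP onQ) => [->|->|->|] //.
- by case: P {onP} => [[x y]|] //=; rewrite !eqxx.
- by rewrite -{2}[P]poppK paddN; case: P {onP} => [[]|].
move=> [l [m [x1 [y1 [x2 [y2 [x3 [y3 [-> -> -> cP]]]]]]]]].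
by rewrite /popp (padd_col_on (col_onN (col_on23 cP))) opprK.
Qed.

Lemma popp_add P Q : oncurve P -> oncurve Q ->
  popp (padd P Q) = padd (popp P) (popp Q).
Proof.
move=> onP onQ; case: (popp_split onP onQ) => [->|->|->|] //.
- by case: P {onP} => [[]|].
- by rewrite poppK paddN -{1}[P]poppK paddN.
move=> [l [m [x1 [y1 [x2 [y2 [x3 [y3 [-> -> -> cP]]]]]]]]].
by rewrite /popp (padd_col_on (col_onN cP)).
Qed.

(* In the function field, the quotient of the lines through P, Q and through
   P + Q, R by the vertical line at P + Q is gamma y - (k X^2 + u1 X + u0); it
   vanishes at P, Q, R and -(P + Q + R). *)
Lemma parabola l1 m1 l2 m2 x1 y1 x2 y2 xs ys x3 y3 x4 y4
  (g := l1 + l2) (u1 := g * l1 - k * (x1 + x2)) (u0 := g * m1 + k * (x1 * x2)) :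
  col_on l1 m1 x1 y1 x2 y2 xs ys -> col_on l2 m2 xs (- ys) x3 y3 x4 y4 ->
  [/\ g * y1 = k * x1 ^+ 2 + u1 * x1 + u0, g * y2 = k * x2 ^+ 2 + u1 * x2 + u0,
      g * y3 = k * x3 ^+ 2 + u1 * x3 + u0, g * y4 = k * x4 ^+ 2 + u1 * x4 + u0
    & k * (x1 + x2 + x3 + x4) = g ^+ 2 - 2 * u1].
Proof.
move=> [[y1E y2E ysE] [e2 e1 _]] [[ysE' y3E y4E] [f2 f1 _]].
have gxs : g * xs = - (m1 + m2).
  by rewrite /g; lincomb (- (1) *e ysE +e - (1) *e ysE').
have d1 : g * (l2 - l1) = k * (x3 + x4 - x1 - x2).
  by rewrite /g; lincomb (f2 +e - (1) *e e2).
have d0 : g * (m2 - m1) = k * (x1 * x2 - x3 * x4).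
  rewrite /g in d1 gxs *.
  lincomb (f1 +e - (1) *e e1 +e xs *e d1 +e - (l2 - l1) *e gxs).
rewrite /u1 /u0; split.
- by rewrite y1E; ring.
- by rewrite y2E; ring.
- by rewrite y3E; lincomb (x3 *e d1 +e d0).
- by rewrite y4E; lincomb (x4 *e d1 +e d0).
- by rewrite /g in d1 *; lincomb (- (1) *e d1).
Qed.

(** The weights in [dd] annihilate 1 and X, which eliminates u1 and u0 and leaves g times [dd] equal
    to k times a nonzero Vandermonde product. This determines g, and also shows g nonzero. *)
Lemma parabola_unique x1 y1 x2 y2 x3 y3 g u1 u0 g' u1' u0' :
  x1 != x2 -> x1 != x3 -> x2 != x3 ->
  g * y1 = k * x1 ^+ 2 + u1 * x1 + u0 -> g * y2 = k * x2 ^+ 2 + u1 * x2 + u0 ->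
  g * y3 = k * x3 ^+ 2 + u1 * x3 + u0 ->
  g' * y1 = k * x1 ^+ 2 + u1' * x1 + u0' -> g' * y2 = k * x2 ^+ 2 + u1' * x2 + u0' ->
  g' * y3 = k * x3 ^+ 2 + u1' * x3 + u0' ->
  [/\ g = g', u1 = u1', u0 = u0' & g != 0].
Proof.
rewrite -subr_eq0 -(subr_eq0 x1 x3) -(subr_eq0 x2) => n12 n13 n23 p1 p2 p3 q1 q2 q3.
pose dd := (x2 - x3) * y1 - (x1 - x3) * y2 + (x1 - x2) * y3.
have ddE : g * dd = k * ((x1 - x2) * (x1 - x3) * (x2 - x3)).
  rewrite /dd; lincomb ((x2 - x3) *e p1 +e - (x1 - x3) *e p2 +e (x1 - x2) *e p3).
have ddE' : g' * dd = k * ((x1 - x2) * (x1 - x3) * (x2 - x3)).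
  rewrite /dd; lincomb ((x2 - x3) *e q1 +e - (x1 - x3) *e q2 +e (x1 - x2) *e q3).
have : g * dd != 0 by rewrite ddE !mulf_neq0.
rewrite mulf_eq0 negb_or => /andP[g0 dd0].
have gg : g = g' by apply: (mulIf dd0); rewrite ddE ddE'.
have uu : u1 = u1'.
  apply: (mulfI n12); rewrite -gg in q1 q2.
  lincomb (q1 +e - (1) *e q2 +e - (1) *e p1 +e p2).
by split=> //; rewrite -gg -uu in q1; lincomb (q1 +e - (1) *e p1).
Qed.

Lemma parabola_unique_tangent x1 y1 x3 y3 l g u1 u0 g' u1' u0' :
  x1 != x3 ->
  g * y1 = k * x1 ^+ 2 + u1 * x1 + u0 -> g * l = 2 * k * x1 + u1 ->
  g * y3 = k * x3 ^+ 2 + u1 * x3 + u0 ->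
  g' * y1 = k * x1 ^+ 2 + u1' * x1 + u0' -> g' * l = 2 * k * x1 + u1' ->
  g' * y3 = k * x3 ^+ 2 + u1' * x3 + u0' ->
  [/\ g = g', u1 = u1', u0 = u0' & g != 0].
Proof.
rewrite -subr_eq0 => n13 p1 p2 p3 q1 q2 q3.
pose dd := y3 - y1 + l * (x1 - x3).
have ddE : g * dd = k * ((x1 - x3) * (x1 - x3)).
  rewrite /dd; lincomb (p3 +e - (1) *e p1 +e (x1 - x3) *e p2).
have ddE' : g' * dd = k * ((x1 - x3) * (x1 - x3)).
  rewrite /dd; lincomb (q3 +e - (1) *e q1 +e (x1 - x3) *e q2).
have : g * dd != 0 by rewrite ddE !mulf_neq0.
rewrite mulf_eq0 negb_or => /andP[g0 dd0].
have gg : g = g' by apply: (mulIf dd0); rewrite ddE ddE'.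
have uu : u1 = u1' by rewrite -gg in q2; lincomb (q2 +e - (1) *e p2).
by split=> //; rewrite -gg -uu in q1; lincomb (q1 +e - (1) *e p1).
Qed.

(** When the point (x1, y1) is added to (x3, y3) twice, it lies on two different lines; the function
    built from them still has a double zero there, and this tangency replaces the missing third
    interpolation point. *)
Lemma parabola_tangent l m l1 m1 l2 m2 x1 y1 xt yt x3 y3 xs ys x4 y4
  (g := l1 + l2) (u1 := g * l1 - k * (x3 + x1)) :
  y1 != 0 -> col_on l m x1 y1 x1 y1 xt yt ->
  col_on l1 m1 x3 y3 x1 y1 xs ys -> col_on l2 m2 xs (- ys) x1 y1 x4 y4 ->
  g * l = 2 * k * x1 + u1.
Proof.
move=> y10 [[y1E _ _] [t2 t1 _]] [[_ y1E1 ysE] [e2 e1 _]] [[ysE' y1E2 _] [f2 _ _]].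
have tl : 2 * y1 * (l - l1) = k * (x1 - x3) * (x1 - xs).
  have p1 : 2 * y1 * l = dcub x1.
    by rewrite /dcub y1E; lincomb (t1 +e (2 * x1) *e t2).
  have p2 : 2 * y1 * l1 = dcub x1 - k * (x1 - x3) * (x1 - xs).
    by rewrite /dcub y1E1; lincomb (e1 +e (2 * x1) *e e2).
  by lincomb (p1 +e - (1) *e p2).
have gx : g * (x1 - xs) = 2 * y1.
  by rewrite /g; lincomb (- (1) *e y1E1 +e - (1) *e y1E2 +e ysE +e ysE').
apply: (mulfI (mulf_neq0 two_neq0 y10)).
by rewrite /u1; lincomb (g *e tl +e (k * (x1 - x3)) *e gx).
Qed.

Lemma padd0 P : padd P None = P.
Proof. by case: P => [[]|]. Qed.

Lemma paddA_rev P Q R : oncurve P -> oncurve Q -> oncurve R ->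
  padd (padd R Q) P = padd R (padd Q P) -> padd (padd P Q) R = padd P (padd Q R).
Proof.
move=> onP onQ onR; have onPQ := oncurve_add onP onQ; have onQR := oncurve_add onQ onR.
by rewrite (paddC onR onQ) (paddC onQ onP) (paddC onQR onP) (paddC onR onPQ) => ->.
Qed.

Lemma paddA_opp12 P Q R : oncurve P -> oncurve Q -> oncurve R ->
  Q = popp P -> padd (padd P Q) R = padd P (padd Q R).
Proof.
move=> onP _ onR ->.
by rewrite -{1}[P]poppK paddN -{1}[P]poppK paddK // oncurve_opp.
Qed.

Lemma paddA_opp13 P Q R : oncurve P -> oncurve Q -> oncurve R ->
  P = popp R -> padd (padd P Q) R = padd P (padd Q R).
Proof.
move=> onP onQ onR PE; have onPQ := oncurve_add onP onQ.
rewrite (paddC onPQ onR) {2}PE (paddC onQ onR) paddK // PE.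
by rewrite -{1}[R]poppK paddK // oncurve_opp.
Qed.

Lemma paddA_oppsum P Q R : oncurve P -> oncurve Q -> oncurve R ->
  R = popp (padd P Q) -> padd (padd P Q) R = padd P (padd Q R).
Proof.
move=> onP onQ onR RE; have onPQ := oncurve_add onP onQ.
rewrite (paddC onPQ onR) {1}RE paddN RE popp_add // paddC ?oncurve_opp //; last first.
  by rewrite oncurve_add ?oncurve_add ?oncurve_opp.
rewrite (paddC (P := popp P)) ?oncurve_opp //.
by rewrite -{1}[Q]poppK paddK ?oncurve_opp // paddN.
Qed.

Lemma parabola_end x1 x2 x3 x4 y4 x5 y5 g u1 u0 :
  g != 0 -> g * y4 = k * x4 ^+ 2 + u1 * x4 + u0 ->
  g * y5 = k * x5 ^+ 2 + u1 * x5 + u0 ->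
  k * (x1 + x2 + x3 + x4) = g ^+ 2 - 2 * u1 ->
  k * (x3 + x2 + x1 + x5) = g ^+ 2 - 2 * u1 -> x4 = x5 /\ y4 = y5.
Proof.
move=> g0 p4 p5 s4 s5.
have x45 : x4 = x5 by apply: (mulfI k_neq0); lincomb (s4 +e - (1) *e s5).
by split=> //; apply: (mulfI g0); rewrite p4 p5 x45.
Qed.

Section TwoWays.
Variables x1 y1 x2 y2 x3 y3 x4 y4 x5 y5 xs ys xt yt : F.
Variables l1 m1 l2 m2 l3 m3 l4 m4 : F.
Hypotheses (c1 : col_on l1 m1 x1 y1 x2 y2 xs ys)
  (c2 : col_on l2 m2 xs (- ys) x3 y3 x4 y4).
Hypotheses (d1 : col_on l3 m3 x3 y3 x2 y2 xt yt)
  (d2 : col_on l4 m4 xt (- yt) x1 y1 x5 y5).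
Hypothesis x13 : x1 != x3.

Lemma two_ways_distinct : x1 != x2 -> x2 != x3 -> x4 = x5 /\ y4 = y5.
Proof.
move=> x12 x23.
have [p1 p2 p3 p4 ps] := parabola c1 c2; have [q3 q2 q1 q4 qs] := parabola d1 d2.
have [gE u1E u0E g0] := parabola_unique x12 x13 x23 p1 p2 p3 q1 q2 q3.
rewrite -u1E -u0E -gE in q4 qs.
exact: (parabola_end g0 p4 q4 ps qs).
Qed.

Lemma two_ways_double : x1 = x2 -> x4 = x5 /\ y4 = y5.
Proof.
move=> x12; have y12 : y1 = y2 by case: c1 => -[-> -> _]; rewrite x12.
have y10 : y1 != 0.
  apply/eqP => y10; have := padd_col_on c1.
  by rewrite -x12 -y12 y10 /padd oppr0 !eqxx.
move: c1 d1; rewrite -x12 -y12 => c1' d1'.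
have [p1 _ p3 p4 ps] := parabola c1' c2; have [q3 _ q1 q4 qs] := parabola d1' d2.
have pt1 : (l1 + l2) * l1 = 2 * k * x1 + ((l1 + l2) * l1 - k * (x1 + x1)) by ring.
have qt1 := parabola_tangent y10 c1' d1' d2.
have [gE u1E u0E g0] := parabola_unique_tangent x13 p1 pt1 p3 q1 qt1 q3.
rewrite -u1E -u0E -gE in q4 qs.
exact: (parabola_end g0 p4 q4 ps qs).
Qed.

End TwoWays.

(** By commutativity the right side is (R + Q) + P. Both orders produce a function of the shape in
    [parabola] vanishing at P, Q, R; there is only one, and its fourth zero is minus either sum. *)
Lemma paddA P Q R : oncurve P -> oncurve Q -> oncurve R ->
  padd (padd P Q) R = padd P (padd Q R).
Proof.
move=> onP onQ onR.
have onPQ := oncurve_add onP onQ; have onRQ := oncurve_add onR onQ.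
case: (popp_split onP onQ) => [->|->|QP|] //; first by rewrite padd0.
  exact: paddA_opp12.
move=> [l1 [m1 [x1 [y1 [x2 [y2 [xs [ys [PE QE PQE c1]]]]]]]]].
case: (popp_split onR onQ) => [->|QE'|QR|]; first by rewrite !padd0.
- by rewrite QE' in QE.
- by apply: paddA_rev => //; apply: paddA_opp12.
move=> [l3 [m3 [x3 [y3 [x2' [y2' [xt [yt [RE]]]]]]]]].
rewrite {1}QE => -[<- <-] {x2' y2'} RQE d1.
case: (popp_split onPQ onR) => [|RE'|RE'|]; first by rewrite PQE.
- by rewrite RE' in RE.
- exact: paddA_oppsum.
move=> [l2 [m2 [xs' [ys' [x3' [y3' [x4 [y4 []]]]]]]]].
rewrite {1}PQE {1}RE => -[<- <-] [<- <-] {xs' ys' x3' y3'} PQRE c2.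
case: (popp_split onRQ onP) => [|PE'|PE'|]; first by rewrite RQE.
- by rewrite PE' in PE.
- by apply: paddA_rev => //; apply: paddA_oppsum.
move=> [l4 [m4 [xt' [yt' [x1' [y1' [x5 [y5 []]]]]]]]].
rewrite {1}RQE {1}PE => -[<- <-] [<- <-] {xt' yt' x1' y1'} RQPE d2.
(* Equal outer abscissas mean R = P or R = -P, where commutativity or cancellation suffices. *)
have [x13|x13] := eqVneq x1 x3.
  have : (y1 == y3) || (y1 == - y3).
    rewrite -eqf_sqr; apply/eqP; move: onP onR; rewrite PE RE /=.
    by move=> /eqP-> /eqP->; rewrite x13.
  case/orP=> /eqP y13.
    have -> : R = P by rewrite RE PE x13 y13.
    by rewrite paddC // (paddC onP onQ).
  by apply: paddA_opp13; rewrite // PE RE x13 y13.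
have [x45 y45] : x4 = x5 /\ y4 = y5.
  have [x12|x12] := eqVneq x1 x2; first exact: (two_ways_double c1 c2 d1 d2).
  have [x23|x23] := eqVneq x2 x3; last exact: (two_ways_distinct c1 c2 d1 d2).
  have [] := two_ways_double d1 d2 c1 c2 _ (esym x23); first by rewrite eq_sym.
  by move=> -> ->.
by rewrite PQRE x45 y45 -RQPE (paddC onRQ onP) (paddC onR onQ).
Qed.

End Cubic.

Record curve (F : fieldType) := Curve {
  ck : F; cA : F; cB : F; cC : F;
  curve_two_neq0 : 2 != 0 :> F;
  curve_k_neq0 : ck != 0;
  curve_smooth : forall x, cub ck cA cB cC x = 0 -> dcub ck cA cB x != 0 }.

Section CurveGroup.
Variables (F : fieldType) (E : curve F).

Record point := Point {
  pval : pt F; pvalP : oncurve (ck E) (cA E) (cB E) (cC E) pval }.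

HB.instance Definition _ := [isSub for pval].
HB.instance Definition _ := [Choice of point by <:].

Let two0 := curve_two_neq0 E.
Let k0 := curve_k_neq0 E.
Let sm := curve_smooth (c := E).

Definition point_add (P Q : point) :=
  Point (oncurve_add two0 k0 sm (pvalP P) (pvalP Q)).
Definition point_opp (P : point) :=
  @Point (popp (pval P)) (etrans (oncurve_opp _ _ _ _ _) (pvalP P)).
Definition point_zero := @Point None isT.

Lemma point_addA : associative point_add.
Proof.
by move=> P Q R; apply/val_inj; rewrite /= (paddA two0 k0 sm (pvalP P) (pvalP Q) (pvalP R)).
Qed.

Lemma point_addC : commutative point_add.
Proof.
by move=> P Q; apply/val_inj; rewrite /= (paddC two0 k0 sm (pvalP P) (pvalP Q)).
Qed.

Lemma point_add0 : left_id point_zero point_add.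
Proof. by move=> P; apply/val_inj. Qed.

Lemma point_addN : left_inverse point_zero point_opp point_add.
Proof. by move=> P; apply/val_inj; rewrite /= paddN. Qed.

HB.instance Definition _ :=
  GRing.isZmodule.Build point point_addA point_addC point_add0 point_addN.

Lemma pvalD (P Q : point) :
  pval (P + Q) = padd (ck E) (cA E) (cB E) (pval P) (pval Q).
Proof. by []. Qed.

Lemma pvalN (P : point) : pval (- P) = popp (pval P).
Proof. by []. Qed.

Lemma pvalMn n (P : point) :
  pval (P *+ n) = iter n (padd (ck E) (cA E) (cB E) (pval P)) None.
Proof. by elim: n => //= n IHn; rewrite mulrS pvalD IHn. Qed.

End CurveGroup.

(** * Valuation rings *)

(** A discrete valuation presented by its ring and a uniformizer: valuation at least n is membership
    of x / pi^n. By [val_total] an element is integral or its inverse lies in the maximal ideal,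
    which also yields the case distinction [val_em]. *)
Record valuation_ring (F : fieldType) (O : F -> Prop) (pi : F) : Prop := {
  val1 : O 1;
  valB : forall x y, O x -> O y -> O (x - y);
  valM : forall x y, O x -> O y -> O (x * y);
  val_pi : O pi;
  val_pi_neq0 : pi != 0;
  val_piV : ~ O pi^-1;
  val_total : forall x, O x \/ O (x^-1 / pi);
  val_sep : forall x, (forall n, O (x / pi ^+ n)) -> x = 0 }.

Section ValuationRing.
Variables (F : fieldType) (O : F -> Prop) (pi : F).
Hypothesis VO : valuation_ring O pi.
Implicit Types (x y : F) (m n : nat).

Definition vdiv n x := O (x / pi ^+ n).

Let pin0 n : pi ^+ n != 0. Proof. exact: expf_neq0 (val_pi_neq0 VO). Qed.

Lemma val0 : O 0. Proof. by rewrite -(subrr 1); apply: (valB VO); apply: (val1 VO). Qed.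
Lemma valN x : O x -> O (- x).
Proof. by move=> Ox; rewrite -sub0r; apply: (valB VO) => //; apply: val0. Qed.
Lemma valD x y : O x -> O y -> O (x + y).
Proof. by move=> Ox Oy; rewrite -[y]opprK; apply: (valB VO) => //; apply: valN. Qed.
Lemma valX x n : O x -> O (x ^+ n).
Proof. by move=> Ox; elim: n => [|n IHn]; rewrite ?exprS; [exact: val1 VO|exact: (valM VO)]. Qed.
Lemma val_nat n : O n%:R.
Proof.
elim: n => [|n IHn]; first exact: val0.
by rewrite -addn1 natrD; apply: valD => //; exact: val1 VO.
Qed.

Lemma vdiv0E x : vdiv 0 x = O x. Proof. by rewrite /vdiv expr0 divr1. Qed.
Lemma vdiv0 n : vdiv n 0. Proof. by rewrite /vdiv mul0r; apply: val0. Qed.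
Lemma vdivN n x : vdiv n x -> vdiv n (- x).
Proof. by rewrite /vdiv mulNr; apply: valN. Qed.
Lemma vdivD n x y : vdiv n x -> vdiv n y -> vdiv n (x + y).
Proof. by rewrite /vdiv mulrDl; apply: valD. Qed.
Lemma vdivB n x y : vdiv n x -> vdiv n y -> vdiv n (x - y).
Proof. by move=> vx vy; apply: vdivD => //; apply: vdivN. Qed.
Lemma vdivM m n x y : vdiv m x -> vdiv n y -> vdiv (m + n) (x * y).
Proof. by rewrite /vdiv => vx vy; rewrite exprD invfM mulrACA; apply: (valM VO). Qed.
Lemma vdiv_le m n x : (m <= n)%N -> vdiv n x -> vdiv m x.
Proof.
move=> mn; rewrite /vdiv => vx.
have -> : x / pi ^+ m = x / pi ^+ n * pi ^+ (n - m).
  by rewrite expfB_cond ?(negPf (val_pi_neq0 VO)) // mulrA -[_ * _ * pi ^+ n]mulrA mulVf ?mulr1.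
by apply: (valM VO) => //; apply: valX; apply: (val_pi VO).
Qed.
Lemma vdivO n x : vdiv n x -> O x.
Proof. by move=> vx; rewrite -vdiv0E; apply: vdiv_le vx. Qed.
Lemma vdivMl n x y : O x -> vdiv n y -> vdiv n (x * y).
Proof. by rewrite -vdiv0E => vx vy; rewrite -[n]add0n; apply: vdivM. Qed.
Lemma vdivMr n x y : vdiv n x -> O y -> vdiv n (x * y).
Proof. by move=> vx vy; rewrite mulrC; apply: vdivMl. Qed.
Lemma vdivX m n x : vdiv n x -> vdiv (m * n) (x ^+ m).
Proof.
move=> vx; elim: m => [|m IHm]; first by rewrite vdiv0E expr0; exact: val1 VO.
by rewrite exprS mulSn; apply: vdivM.
Qed.

Lemma vdiv1_neq1 : ~ vdiv 1 1.
Proof. by rewrite /vdiv mul1r expr1; apply: (val_piV VO). Qed.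

Lemma val_or_vdivV x : O x \/ vdiv 1 x^-1.
Proof. by rewrite /vdiv expr1; apply: (val_total VO). Qed.

Lemma vdiv1_or_valV x : vdiv 1 x \/ O x^-1.
Proof. by have [|] := val_or_vdivV x^-1; rewrite ?invrK; [right|left]. Qed.

Lemma val_em x : O x \/ ~ O x.
Proof.
have [->|x0] := eqVneq x 0; first by left; apply: val0.
have [|vx] := val_or_vdivV x; first by left.
by right=> Ox; apply: vdiv1_neq1; rewrite -(mulfV x0); apply: vdivMl.
Qed.

Lemma unit_neq_vdiv1 x : x != 0 -> O x^-1 -> ~ vdiv 1 x.
Proof. by move=> x0 Ox vx; apply: vdiv1_neq1; rewrite -(mulfV x0); apply: vdivMr. Qed.

Lemma one_sub_neq0 t : vdiv 1 t -> 1 - t != 0.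
Proof. by move=> vt; apply/eqP => /subr0_eq t1; apply: vdiv1_neq1; rewrite t1. Qed.

Lemma one_sub_unit t : vdiv 1 t -> O (1 - t)^-1.
Proof.
move=> vt; have [v1|//] := vdiv1_or_valV (1 - t).
by case: vdiv1_neq1; rewrite -(subrK t 1); apply: vdivD.
Qed.

Lemma vdiv_unit n x u : u != 0 -> O u^-1 -> vdiv n (u * x) -> vdiv n x.
Proof. by move=> u0 Ou vx; rewrite -(mulKf u0 x); apply: vdivMl. Qed.

Lemma val_sqrt x : O (x ^+ 2) -> O x.
Proof.
have [//|vx] := val_or_vdivV x => Ox2; have [->|x0] := eqVneq x 0; first exact: val0.
have := vdivMr (vdivX 2 vx) Ox2; rewrite exprVn mulVf ?expf_neq0 // => v1.
by case: vdiv1_neq1; apply: vdiv_le v1.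
Qed.

Lemma vdiv1_prime x y : O x -> O y -> vdiv 1 (x * y) -> vdiv 1 x \/ vdiv 1 y.
Proof.
move=> Ox Oy vxy; have [|Ox'] := vdiv1_or_valV x; first by left.
have [->|x0] := eqVneq x 0; first by left; apply: vdiv0.
by right; apply: vdiv_unit vxy.
Qed.

Lemma vdiv1_sqrt x : O x -> vdiv 1 (x ^+ 2) -> vdiv 1 x.
Proof. by move=> Ox; rewrite expr2 => /(vdiv1_prime Ox Ox)[]. Qed.

Lemma vdiv_all x : (forall n, vdiv n x) -> x = 0.
Proof. exact: (val_sep VO). Qed.

End ValuationRing.

(** * Torsion injects into the reduction *)

Section Reduction.
Variables (F : fieldType) (O : F -> Prop) (pi : F).
Hypothesis VO : valuation_ring O pi.
Variable E : curve F.
Notation k := (ck E).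
Notation A := (cA E).
Notation B := (cB E).
Notation C := (cC E).
Hypotheses (Ok : O k) (OkV : O k^-1) (OA : O A) (OB : O B) (OC : O C).
Local Notation vdiv := (vdiv O pi).
Local Notation fE := (cub k A B C).
Local Notation dfE := (dcub k A B).
Local Notation on := (oncurve k A B C).
Local Notation col := (col_on k A B C).
Let two0 := curve_two_neq0 E.
Let k0 := curve_k_neq0 E.
Let sm := curve_smooth (c := E).
Implicit Types (P Q : pt F) (n : nat).

(* Near infinity we use the coordinates z = x / y and w = 1 / y, in which the
   curve reads w = k z^3 + A z^2 w + B z w^2 + C w^3. *)
Definition zcoord P : F := if P is Some (x, y) then x / y else 0.

(** The bound on 1 / y separates points near infinity from affine points with small z: on an induced
    curve (0, 1) also has z = 0. *)
Definition in_ker n P : Prop :=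
  if P is Some (x, y) then [/\ y != 0, vdiv n (x / y) & vdiv 1 y^-1] else True.

Lemma cub_zw x y : y != 0 -> y ^+ 2 = fE x ->
  y^-1 = k * (x / y) ^+ 3 + A * (x / y) ^+ 2 * y^-1 + B * (x / y) * y^-1 ^+ 2 + C * y^-1 ^+ 3.
Proof.
move=> y0 e; have -> : y^-1 = y ^+ 2 / y ^+ 3 by field.
by rewrite {1}e /cub; field.
Qed.

(** Collecting the terms divisible by w gives (1 - t) w = k z^3 with t in the maximal ideal, so w is
    a unit times z^3. *)
Lemma in_ker_w n x y : on (Some (x, y)) -> (0 < n)%N -> in_ker n (Some (x, y)) ->
  vdiv (3 * n) y^-1.
Proof.
move=> /eqP onP n0 [y0 vz vw]; have zwE := cub_zw y0 onP.
set z := x / y in vz zwE; set w := y^-1 in vw zwE *.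
have v1z : vdiv 1 z by apply: vdiv_le vz.
pose t := A * z ^+ 2 + B * z * w + C * w ^+ 2.
have vt : vdiv 1 t.
  apply: vdivD => //; [apply: vdivD => //|].
  - by apply: vdivMl => //; apply: (vdiv_le VO _ (vdivX VO 2 v1z)).
  - by rewrite -mulrA; apply: vdivMl => //; apply: (vdiv_le VO _ (vdivM VO v1z vw)).
  - by apply: vdivMl => //; apply: (vdiv_le VO _ (vdivX VO 2 vw)).
apply: (vdiv_unit VO (one_sub_neq0 VO vt) (one_sub_unit VO vt)).
have -> : (1 - t) * w = k * z ^+ 3 by rewrite /t; lincomb (1 *e zwE).
by apply: vdivMl => //; apply: vdivX.
Qed.

(* The chord l x + m = y becomes w = alpha z + beta with alpha = - l / m and
   beta = 1 / m; alpha has valuation 2n and beta has valuation 3n. *)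
Lemma chord_estimate n l m x1 y1 x2 y2 x3 y3 : (0 < n)%N ->
  col l m x1 y1 x2 y2 x3 y3 -> y1 != 0 -> y2 != 0 ->
  vdiv n (x1 / y1) -> vdiv n (x2 / y2) ->
  vdiv (3 * n) y1^-1 -> vdiv (3 * n) y2^-1 ->
  [/\ y3 != 0, vdiv n (x3 / y3), vdiv 1 y3^-1
    & vdiv (3 * n) (x1 / y1 + x2 / y2 + x3 / y3)].
Proof.
move=> n0 [[y1E y2E y3E] [e2 e1 e0]] y10 y20 vz1 vz2 vw1 vw2.
have AE : A = l ^+ 2 - k * (x1 + x2 + x3) by lincomb (-1 *e e2).
have BE : B = 2 * (l * m) + k * (x1 * x2 + x1 * x3 + x2 * x3) by lincomb (-1 *e e1).
have CE : C = m ^+ 2 - k * (x1 * x2 * x3) by lincomb (-1 *e e0).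
have le13 : (1 <= 3 * n)%N by rewrite muln_gt0.
have le12 : (1 <= 2 * n)%N by rewrite muln_gt0.
have [[z1 z1E] [z2 z2E]] : (exists z, z = x1 / y1) /\ (exists z, z = x2 / y2).
  by split; eexists.
have [[w1 w1E] [w2 w2E]] : (exists w, w = y1^-1) /\ (exists w, w = y2^-1).
  by split; eexists.
rewrite -z1E -z2E -?w1E -?w2E in vz1 vz2 vw1 vw2 *.
have v1z1 := vdiv_le VO n0 vz1; have v1z2 := vdiv_le VO n0 vz2.
have v1w1 := vdiv_le VO le13 vw1; have v1w2 := vdiv_le VO le13 vw2.
have Oz1 := vdivO VO vz1; have Oz2 := vdivO VO vz2.
have Ow1 := vdivO VO vw1; have Ow2 := vdivO VO vw2.
(* Subtracting the two (z, w) equations gives (1 - t) (w1 - w2) = N (z1 - z2), hence (1 - t) alpha =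
   N, an identity that remains valid for tangents. *)
pose t := A * z2 ^+ 2 + B * z2 * (w1 + w2) + C * (w1 ^+ 2 + w1 * w2 + w2 ^+ 2).
have vt : vdiv 1 t.
  rewrite /t !expr2 -!mulrA.
  by repeat first [done | apply: vdivD => // | apply: vdivMl => //].
(* A line through the origin would make t = 1. *)
have m0 : m != 0.
  apply/eqP => m0; have := one_sub_neq0 VO vt; case/eqP.
  move: y10 y20; rewrite y1E y2E m0 !addr0 !mulf_eq0 !negb_or => /andP[l0 x10] /andP[_ x20].
  rewrite /t z2E w1E w2E y1E y2E AE BE CE m0.
  by field; rewrite ?l0 ?x10 ?x20.
pose al := - l / m; pose be := m^-1.
pose N := k * (z1 ^+ 2 + z1 * z2 + z2 ^+ 2) + A * w1 * (z1 + z2) + B * w1 ^+ 2.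
have vN : vdiv (2 * n) N.
  have le23 : (2 * n <= 3 * n)%N by rewrite leq_mul2r orbT.
  have vw1' := vdiv_le VO le23 vw1.
  have vzz : forall x y, vdiv n x -> vdiv n y -> vdiv (2 * n) (x * y).
    by move=> x y vx vy; rewrite mul2n -addnn; apply: vdivM.
  rewrite /N -!mulrA !expr2.
  have Oz12 : O (z1 + z2) by apply: (valD VO).
  by repeat first [done | apply: vdivD => // | by apply: vzz | by apply: vdivMr
    | apply: vdivMl => //].
have alN : (1 - t) * al = N.
  have y10' := y10; have y20' := y20; rewrite y1E in y10'; rewrite y2E in y20'.
  rewrite /t /N /al z1E z2E w1E w2E y1E y2E AE BE CE.
  by field; rewrite ?m0 ?y10' ?y20'.
have val : vdiv (2 * n) al.
  by apply: (vdiv_unit VO (one_sub_neq0 VO vt) (one_sub_unit VO vt)); rewrite alN.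
have beE : be = w1 - al * z1.
  by rewrite /be /al w1E z1E y1E; field; rewrite m0 -y1E y10.
have vbe : vdiv (3 * n) be.
  by rewrite beE; apply: vdivB => //; rewrite mulSn addnC; apply: vdivM.
(* Substituting w = alpha z + beta gives a cubic in z with leading coefficient k (1 - s). [sumE] is
   the Vieta relation for the sum of its roots, and every term on its right contains beta. *)
pose s := - (A * al + B * al ^+ 2 + C * al ^+ 3) / k.
have v1al := vdiv_le VO le12 val; have Oal := vdivO VO val.
have vs : vdiv 1 s.
  rewrite /s; apply: vdivMr => //; apply: vdivN => //; rewrite !exprS expr0 mulr1.
  by repeat first [done | apply: vdivD => // | apply: vdivMl => //].
have leadE : k * (1 - s) = k * be ^+ 3 * (y1 * y2 * y3).
  by rewrite /s /be /al y1E y2E y3E AE BE CE; field; rewrite m0 k0.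
have lead0 : k * (1 - s) != 0 by rewrite mulf_neq0 // (one_sub_neq0 VO vs).
have y30 : y3 != 0 by apply: contraNneq lead0 => y30; rewrite leadE y30 !mulr0.
have sumE : (1 - s) * (z1 + z2 + x3 / y3) =
    - (A * be + 2 * B * al * be + 3 * C * al ^+ 2 * be) / k.
  move: y10 y20 y30; rewrite /s /be /al z1E z2E y1E y2E y3E => y10 y20 y30.
  by rewrite AE BE CE; field; rewrite ?m0 ?k0 ?y10 ?y20 ?y30.
have vsum : vdiv (3 * n) (z1 + z2 + x3 / y3).
  apply: (vdiv_unit VO (one_sub_neq0 VO vs) (one_sub_unit VO vs)); rewrite sumE.
  apply: vdivMr => //; apply: vdivN => //.
  by repeat first [done | apply: vdivD => // | apply: vdivMl => // | apply: (valM VO)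
     | exact: (val_nat VO) | apply: (valX VO)].
have vz3 : vdiv n (x3 / y3).
  have -> : x3 / y3 = (z1 + z2 + x3 / y3) - z1 - z2 by ring.
  by apply: vdivB => //; apply: vdivB => //; apply: (vdiv_le VO _ vsum); rewrite leq_pmull.
split=> //.
have -> : y3^-1 = al * (x3 / y3) + be.
  by move: y30; rewrite /al /be y3E => y30; field; rewrite m0 y30.
apply: vdivD => //; first by apply: vdivMr => //; apply: (vdivO VO vz3).
exact: vdiv_le vbe.
Qed.

Lemma in_ker_add n P Q : (0 < n)%N -> on P -> on Q -> in_ker n P -> in_ker n Q ->
  in_ker n (padd k A B P Q) /\
  vdiv (3 * n) (zcoord (padd k A B P Q) - zcoord P - zcoord Q).
Proof.
move=> n0 onP onQ kP kQ.
case: (popp_split two0 k0 sm onP onQ) => [PE|QE|QE|].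
- by subst P; rewrite /= subr0 subrr; split=> //; apply: vdiv0.
- by subst Q; rewrite padd0 /= subrr subr0; split=> //; apply: vdiv0.
- subst Q; rewrite (paddC two0 k0 sm) ?oncurve_opp // paddN; split=> //.
  case: P {onP onQ kP kQ} => [[x y]|] /=; last by rewrite !subr0; apply: vdiv0.
  by rewrite invrN mulrN sub0r opprK addNr; apply: vdiv0.
move=> [l [m [x1 [y1 [x2 [y2 [x3 [y3 [PE QE -> c]]]]]]]]].
rewrite PE in onP kP *; rewrite QE in onQ kQ *.
have vw1 := in_ker_w onP n0 kP; have vw2 := in_ker_w onQ n0 kQ.
case: kP kQ => [y10 vz1 _] [y20 vz2 _].
have [y30 vz3 vw3 vs] := chord_estimate n0 c y10 y20 vz1 vz2 vw1 vw2.
rewrite /= invrN mulrN -!opprD; split; last by apply: vdivN; rewrite // -addrA addrC.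
by split; [rewrite oppr_eq0|apply: vdivN|apply: vdivN].
Qed.

Lemma in_ker_mul n (P : point E) m : (0 < n)%N -> in_ker n (pval P) ->
  in_ker n (pval (P *+ m)) /\
  vdiv (3 * n) (zcoord (pval (P *+ m)) - m%:R * zcoord (pval P)).
Proof.
move=> n0 kP; elim: m => [|m [IHk IHz]].
  by rewrite mulr0n mul0r subr0; split=> //; apply: vdiv0.
have [kS zS] := in_ker_add n0 (pvalP P) (pvalP (P *+ m)) kP IHk.
rewrite mulrS; split=> //; rewrite pvalD -[m.+1]addn1 natrD.
set s := zcoord (padd _ _ _ _ _) in zS *.
have -> : s - (m%:R + 1%:R) * zcoord (pval P) = (s - zcoord (pval P) - zcoord (pval (P *+ m)))
   + (zcoord (pval (P *+ m)) - m%:R * zcoord (pval P)) by ring.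
exact: vdivD.
Qed.

Hypothesis vdiv_prime : forall l n x, prime l -> vdiv n.+1 (l%:R * x) -> vdiv n x.

(** If l P = 0, then l z has valuation at least 3 n; as l has valuation at most 1, z has valuation
    at least 3 n - 1 > n. Iterating gives z = 0, hence 1 / y = 0, which no affine point allows. The
    argument includes the case where l is the residue characteristic. *)
Lemma in_ker_torsion_prime (P : point E) l :
  prime l -> in_ker 1 (pval P) -> P *+ l = 0 -> P = 0.
Proof.
move=> pl kP lP; case EP : (pval P) kP => [[x y]|] kP; last exact/val_inj.
have onP := pvalP P; rewrite EP in onP.
have kn n : in_ker n.+1 (Some (x, y)).
  elim: n => // n IHn; rewrite -EP in IHn.
  have [_] := in_ker_mul l (ltn0Sn n) IHn; rewrite lP EP /= sub0r => /(vdivN VO).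
  rewrite opprK mulnS addSn => /(vdiv_prime pl) vz.
  case: kP => y0 _ vw; split=> //.
  by apply: (vdiv_le VO _ vz); rewrite !addSn add0n !ltnS mulSn leq_addr.
have z0 : x / y = 0.
  by apply: (vdiv_all VO) => n; case: (kn n) => _ vz _; apply: (vdiv_le VO _ vz).
have y0 : y^-1 = 0.
  apply: (vdiv_all VO) => n; have := in_ker_w onP (ltn0Sn n) (kn n).
  by apply: vdiv_le => //; rewrite mulSn; apply: leq_trans (leqnSn n) (leq_addr _ _).
by case: kP => /negP[]; rewrite -invr_eq0 y0.
Qed.

Lemma in_ker_torsion (P : point E) m :
  (0 < m)%N -> in_ker 1 (pval P) -> P *+ m = 0 -> P = 0.
Proof.
elim/ltn_ind: m P => m IHm P m0 kP mP.
have [m1|m1] := leqP m 1; first by (have m1' : m = 1%N by lia); rewrite m1' in mP.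
have pl := pdiv_prime m1; have dl := pdiv_dvd m.
have mE : m = (m %/ pdiv m * pdiv m)%N by rewrite divnK.
have m'0 : (0 < m %/ pdiv m)%N by rewrite divn_gt0 ?pdiv_gt0 // dvdn_leq.
apply: (IHm (m %/ pdiv m)%N) => //; first by rewrite ltn_Pdiv // prime_gt1.
apply: in_ker_torsion_prime pl _ _; last by rewrite -mulrnA -mE.
by have [] := in_ker_mul (m %/ pdiv m) (ltn0Sn 0) kP.
Qed.

(** For large x the leading term dominates: y^2 = x^3 times a unit, so (x / y)^2 is 1 / x times a
    unit. *)
Lemma nonintegral_in_ker x y : on (Some (x, y)) -> ~ O x -> in_ker 1 (Some (x, y)).
Proof.
move=> /eqP onP nOx.
have [//|vx] := val_or_vdivV VO x.
have x0 : x != 0 by apply: contra_not_neq nOx => ->; apply: (val0 VO).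
pose t := - (A * x^-1 + B * x^-1 ^+ 2 + C * x^-1 ^+ 3) / k.
have vt : vdiv 1 t.
  rewrite /t; apply: vdivMr => //; apply: vdivN => //; rewrite !exprS expr0 mulr1.
  have Ox := vdivO VO vx.
  by repeat first [done | apply: vdivD => // | apply: vdivMl => //].
have u0 := one_sub_neq0 VO vt.
have yE : y ^+ 2 = x ^+ 3 * (k * (1 - t)).
  by rewrite onP /t /cub; field; rewrite k0 x0.
have y0 : y != 0.
  by rewrite -sqrf_eq0 yE !mulf_neq0 ?expf_neq0.
have vz : vdiv 1 (x / y).
  have vz2 : vdiv 1 ((x / y) ^+ 2).
    have -> : (x / y) ^+ 2 = x^-1 * (k^-1 * (1 - t)^-1).
      by rewrite expr_div_n yE; field; rewrite k0 x0 u0.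
    by apply: vdivMr => //; apply: (valM VO) => //; apply: (one_sub_unit VO).
  apply: (vdiv1_sqrt VO _ vz2); apply: (val_sqrt VO); exact: (vdivO VO vz2).
split=> //; have -> : y^-1 = x / y * x^-1 by field; rewrite y0 x0.
by apply: vdivMl => //; apply: (vdivO VO vz).
Qed.

Hypothesis O2V : O 2^-1.
Hypothesis smooth_red : forall x, O x -> vdiv 1 (fE x) -> ~ vdiv 1 (dfE x).

Definition cong_pt P Q : Prop :=
  (in_ker 1 P /\ in_ker 1 Q) \/
  (exists x1 y1 x2 y2, [/\ P = Some (x1, y1), Q = Some (x2, y2),
    [/\ O x1, O y1 & O x2] & vdiv 1 (x1 - x2) /\ vdiv 1 (y1 - y2)]).

(** If the difference had integral abscissa, the line through (x1, y1) and (x2, - y2) would have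
    integral slope. Then 2 y1 is congruent to 0, and so are the cubic and its derivative at x1: the
    reduction would be singular. *)
Lemma sub_integral_in_ker x1 y1 x2 y2 :
  on (Some (x1, y1)) -> on (Some (x2, y2)) -> O x1 -> O y1 -> O x2 ->
  vdiv 1 (x1 - x2) -> vdiv 1 (y1 - y2) ->
  in_ker 1 (padd k A B (Some (x1, y1)) (popp (Some (x2, y2)))).
Proof.
move=> on1 on2 Ox1 Oy1 Ox2 vx vy; set Q := popp _.
have onQ : on Q by rewrite oncurve_opp.
case: (popp_split two0 k0 sm on1 onQ) => // [QE|].
  by rewrite QE (paddC two0 k0 sm) ?oncurve_opp // paddN.
move=> [l [m [x [y [x' [y' [x3 [y3 [[<- <-] [<- <-] sE c]]]]]]]]] {x y x' y'}.
have on3 : on (Some (x3, - y3)) by rewrite -sE; apply: oncurve_add.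
rewrite sE; apply: nonintegral_in_ker => // Ox3.
case: c => [[y1E y2E _] [e2 e1 _]].
have Ol : O l.
  apply: (val_sqrt VO); rewrite e2; apply: (valD VO) => //; apply: (valM VO) => //.
  by apply: (valD VO) => //; apply: (valD VO).
have vy1 : vdiv 1 y1.
  apply: (vdiv_unit VO two0 O2V).
  have -> : 2 * y1 = l * (x1 - x2) + (y1 - y2) by lincomb (1 *e y1E +e -1 *e y2E).
  by apply: vdivD => //; apply: vdivMl.
apply: (smooth_red Ox1).
  by move/eqP: on1 => <-; rewrite expr2; apply: vdivMr.
have -> : dfE x1 = 2 * l * y1 + k * (x1 - x3) * (x1 - x2).
  by rewrite /dcub y1E; lincomb (-1 *e e1 +e (- 2 * x1) *e e2).
apply: vdivD => //; apply: vdivMl => //; first by apply: (valM VO) => //; apply: (val_nat VO).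
by apply: (valM VO) => //; apply: (valB VO).
Qed.

Theorem torsion_cong_eq (P Q : point E) m n :
  (0 < m)%N -> P *+ m = 0 -> (0 < n)%N -> Q *+ n = 0 ->
  cong_pt (pval P) (pval Q) -> P = Q.
Proof.
move=> m0 mP n0 nQ PQ; apply/eqP; rewrite -subr_eq0; apply/eqP.
apply: (@in_ker_torsion _ (m * n)); first by rewrite muln_gt0 m0.
  rewrite pvalD pvalN; have onP := pvalP P; have onQ := pvalP Q.
  have kB : in_ker 1 (pval P) -> in_ker 1 (pval Q) ->
      in_ker 1 (padd k A B (pval P) (popp (pval Q))).
    move=> kP kQ; case: (@in_ker_add 1 (pval P) (popp (pval Q))) => //.
      by rewrite oncurve_opp.
    case: (pval Q) kQ => [[x y]|] // [y0 vz vw].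
    by split; rewrite ?oppr_eq0 ?invrN ?mulrN //; apply: vdivN.
  case: PQ => [[kP kQ]|]; first exact: kB.
  move=> [x1 [y1 [x2 [y2 [PE QE [Ox1 Oy1 Ox2] [vx vy]]]]]].
  by rewrite PE QE in onP onQ *; apply: sub_integral_in_ker.
by rewrite mulrnBl mulrnA mP mul0rn mulnC mulrnA nQ mul0rn subrr.
Qed.

End Reduction.

(** * Rationals integral at p, and their quadratic extensions *)

Definition pint (p : nat) (x : rat) : Prop :=
  exists n d : int, ~~ (p %| d)%Z /\ x = n%:~R / d%:~R.

Section PIntegral.
Variable p : nat.
Hypothesis p_prime : prime p.

Let dvdzMp (m n : int) : (p %| m * n)%Z = (p %| m)%Z || (p %| n)%Z.
Proof. by rewrite !dvdzE abszM Euclid_dvdM. Qed.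

Let dn0 (d : int) : ~~ (p %| d)%Z -> d%:~R != 0 :> rat.
Proof. by apply: contraNneq => /eqP; rewrite intr_eq0 => /eqP->; rewrite dvdz0. Qed.

Lemma pint_int (n : int) : pint p n%:~R.
Proof.
exists n, 1; rewrite divr1; split=> //.
by rewrite dvdzE dvdn1 neq_ltn prime_gt1 ?orbT.
Qed.

Lemma pint_frac (n d : int) : ~~ (p %| d)%Z -> pint p (n%:~R / d%:~R).
Proof. by exists n, d. Qed.

Let p0 : p%:R != 0 :> rat. Proof. by rewrite pnatr_eq0 -lt0n prime_gt0. Qed.

Lemma pint_valuation_ring : valuation_ring (pint p) p%:R.
Proof.
split=> //.
- exact: (pint_int 1).
- move=> _ _ [n [d [pd ->]]] [n' [d' [pd' ->]]]; exists (n * d' - n' * d), (d * d').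
  rewrite dvdzMp negb_or pd; split=> //.
  by rewrite rmorphB !rmorphM /=; field; rewrite !dn0.
- move=> _ _ [n [d [pd ->]]] [n' [d' [pd' ->]]]; exists (n * n'), (d * d').
  rewrite dvdzMp negb_or pd; split=> //.
  by rewrite !rmorphM /=; field; rewrite !dn0.
- exact: (pint_int p).
- move=> [n [d [pd e]]]; apply: (negP pd).
  have : d%:~R = (n * p)%:~R :> rat.
    rewrite rmorphM /= -pmulrn; move/eqP: e.
    by rewrite -div1r (eqr_div _ _ p0 (dn0 pd)) mul1r => /eqP.
  by move/intr_inj->; rewrite dvdz_mull.
- move=> x; have [pd|pd] := boolP (p %| denq x)%Z; last first.
    by left; exists (numq x), (denq x); rewrite divq_num_den.
  right; exists (denq x %/ p)%Z, (numq x); split.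
    apply/negP => pn; have := coprime_num_den x.
    have : (p %| gcdn `|numq x| `|denq x|)%N.
      by rewrite dvdn_gcd; rewrite !dvdzE in pn pd; rewrite pn pd.
    by move=> h /eqP e; move: h; rewrite e dvdn1 => /eqP p1; move: p_prime; rewrite p1.
  have dE : (denq x)%:~R = (denq x %/ p)%Z%:~R * p%:R :> rat.
    by rewrite -{1}(divzK pd) rmorphM.
  by rewrite -{1}[x]divq_num_den dE invf_div mulrAC mulfK.
- move=> x vx; have [n [d [pd xE]]] := vx 0%N; rewrite expr0 divr1 in xE.
  have pn m : (p%:Z ^+ m %| n)%Z.
    have [n' [d' [pd' e]]] := vx m.
    have dv : (p%:Z ^+ m %| n * d')%Z.
      apply/dvdzP; exists (n' * d); apply: (@intr_inj rat).
      rewrite !rmorphM rmorphXn /=.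
      have pm0 : p%:R ^+ m != 0 :> rat by rewrite expf_neq0.
      have h : n%:~R / d%:~R = n'%:~R / d'%:~R * p%:R ^+ m :> rat.
        by rewrite -e divfK // xE.
      have d0 := dn0 pd; have d'0 := dn0 pd'; rewrite -pmulrn.
      transitivity (n%:~R / d%:~R * (d%:~R * d'%:~R) : rat); first by field; rewrite d0.
      by rewrite h; field; rewrite d'0.
    rewrite Gauss_dvdzl // in dv.
    by rewrite coprimezE abszX coprimeXl // prime_coprime // -dvdzE.
  rewrite xE; suff -> : n = 0 by rewrite mul0r.
  (* The exponent |n| is large enough: p^|n| > |n|, so p^|n| divides n only for n = 0. *)
  apply/eqP; rewrite -absz_eq0; apply/eqP.
  have := pn `|n|%N; rewrite dvdzE abszX absz_nat => /dvdn_leq.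
  case: posnP => // n0 /(_ isT); rewrite leqNgt ltn_expl // prime_gt1 //.
Qed.

Lemma vdiv_int (n : int) : vdiv (pint p) p%:R 1 n%:~R <-> (p %| n)%Z.
Proof.
split=> [|/dvdzP[m ->]].
  rewrite /vdiv expr1 => -[n' [d [pd e]]].
  have : (p %| n * d)%Z.
    apply/dvdzP; exists n'; apply: (@intr_inj rat); rewrite !rmorphM /= -pmulrn.
    transitivity (n%:~R / p%:R * (p%:R * d%:~R) : rat); first by field.
    by rewrite e; field; rewrite dn0.
  by rewrite dvdzMp (negPf pd) orbF.
rewrite /vdiv expr1 rmorphM /= -pmulrn mulfK //; exact: pint_int.
Qed.

Lemma pintV (n : int) : ~~ (p %| n)%Z -> pint p n%:~R^-1.
Proof. by move=> pn; rewrite -div1r; apply: (pint_frac 1). Qed.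

Lemma pint_residue (x : rat) : pint p x -> exists n : int, vdiv (pint p) p%:R 1 (x - n%:~R).
Proof.
move=> [n [d [pd ->]]].
have cdp : coprimez d p.
  by rewrite coprimez_sym coprimezE prime_coprime // -dvdzE.
have [[u v] /= uv] := coprimezP _ _ cdp.
exists (n * u); rewrite /vdiv expr1.
have -> : (n%:~R / d%:~R - (n * u)%:~R) / p%:R = (n * v)%:~R / d%:~R :> rat.
  have -> : n%:~R / d%:~R = n%:~R * (u * d + v * p)%:~R / d%:~R :> rat.
    by rewrite uv mulr1.
  by rewrite !(rmorphD, rmorphM) /= -pmulrn; field; rewrite p0 dn0.
exact: pint_frac.
Qed.

End PIntegral.

Section QuadraticExtension.
Variables (F : fieldType) (j : {rmorphism rat -> F}) (kap : F) (W : rat) (p : nat).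
Hypotheses (p_prime : prime p) (kapE : kap ^+ 2 = j W) (pW : pint p W).
Hypothesis F_spanned : forall x : F, exists a b : rat, x = j a + j b * kap.
Local Notation Op := (pint p).
Local Notation pdiv := (vdiv (pint p) p%:R 1).
(* p is inert: a^2 - W b^2 has no nontrivial zero modulo p. *)
Hypothesis inert : forall a b, Op a -> Op b -> pdiv (a ^+ 2 - W * b ^+ 2) ->
  pdiv a /\ pdiv b.

Let Vp := pint_valuation_ring p_prime.

Definition qint (x : F) : Prop := exists a b, [/\ Op a, Op b & x = j a + j b * kap].

(** Otherwise (r, 1) would be a nontrivial zero of the norm form modulo p. *)
Lemma W_nonsquare (r : rat) : W != r ^+ 2.
Proof.
apply/eqP => WE; have Or : Op r by apply: (val_sqrt Vp); rewrite -WE.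
have [] := inert Or (val1 Vp).
  by rewrite expr1n mulr1 WE subrr; apply: (vdiv0 Vp).
by move=> _; apply: (vdiv1_neq1 Vp).
Qed.

Lemma coord_eq0 a b : j a + j b * kap = 0 -> a = 0 /\ b = 0.
Proof.
move=> e; suff b0 : b = 0.
  by split=> //; apply: (fmorph_inj j); rewrite rmorph0 -e b0 rmorph0 mul0r addr0.
apply/eqP; apply: contraT => b0; case/eqP: (W_nonsquare (a / b)).
apply: (fmorph_inj j); rewrite -kapE rmorphXn fmorph_div /=.
have jb0 : j b != 0 by rewrite fmorph_eq0.
have -> : j a = - (j b * kap) by apply/eqP; rewrite -addr_eq0 e.
by field.
Qed.

Lemma coord_inj a b a' b' :
  j a + j b * kap = j a' + j b' * kap -> a = a' /\ b = b'.
Proof.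
move=> e; have : j (a - a') + j (b - b') * kap = 0.
  by rewrite !rmorphB /=; lincomb (1 *e e).
by case/coord_eq0 => /subr0_eq-> /subr0_eq->.
Qed.

Lemma qintE a b : qint (j a + j b * kap) <-> Op a /\ Op b.
Proof.
split=> [[a' [b' [Oa Ob /coord_inj[-> ->]]]] | [Oa Ob]] //.
by exists a, b.
Qed.

Lemma qint_rat a : Op a -> qint (j a).
Proof.
by move=> Oa; exists a, 0; split; rewrite // ?(val0 Vp) ?rmorph0 ?mul0r ?addr0 //; apply: (val0 Vp).
Qed.

Let p0 : p%:R != 0 :> rat. Proof. by rewrite pnatr_eq0 -lt0n prime_gt0. Qed.

Lemma coord_divp a b n :
  (j a + j b * kap) / p%:R ^+ n = j (a / p%:R ^+ n) + j (b / p%:R ^+ n) * kap.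
Proof. by rewrite !fmorph_div !rmorphXn /= !rmorph_nat mulrDl mulrAC. Qed.

Lemma qint_valuation_ring : valuation_ring qint p%:R.
Proof.
have jp : p%:R = j p%:R by rewrite rmorph_nat.
have qM x y : qint x -> qint y -> qint (x * y).
  move=> [a [b [Oa Ob ->]]] [a' [b' [Oa' Ob' ->]]].
  exists (a * a' + W * b * b'), (a * b' + b * a'); split.
  - by apply: (valD Vp); apply: (valM Vp) => //; apply: (valM Vp).
  - by apply: (valD Vp); apply: (valM Vp).
  - rewrite !rmorphD !rmorphM /= -kapE; ring.
split=> //.
- by rewrite -(rmorph1 j); apply: qint_rat; apply: (val1 Vp).
- move=> _ _ [a [b [Oa Ob ->]]] [a' [b' [Oa' Ob' ->]]].
  exists (a - a'), (b - b'); rewrite !rmorphB /=; split; try exact: (valB Vp).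
  ring.
- by rewrite jp; apply: qint_rat; apply: (val_pi Vp).
- by rewrite jp fmorph_eq0.
- move=> qp; apply: (val_piV Vp).
  suff [] : Op p%:R^-1 /\ Op 0 by [].
  by apply/qintE; rewrite rmorph0 mul0r addr0 fmorphV rmorph_nat.
- move=> x; have [a [b xE]] := F_spanned x.
  have [->|x0] := eqVneq x 0.
    by left; rewrite -(rmorph0 j); apply: qint_rat; apply: (val0 Vp).
  (* Dividing by the coordinate of smaller valuation makes one coordinate 1. By inertness the norm
     of the remaining factor is then a unit at p, so that factor is a unit of [qint] and the
     rational c carries the whole valuation of x. *)
  have [c [a' [b' [c0 [Oa' Ob'] ab1 xE']]]] : exists c a' b', [/\ c != 0, Op a' /\ Op b',
      a' = 1 \/ b' = 1 & x = j c * (j a' + j b' * kap)].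
    have [b0|b0] := eqVneq b 0.
      have a0 : a != 0.
        by apply: contraNneq x0 => a0; rewrite xE a0 b0 rmorph0 mul0r addr0.
      exists a, 1, 0; split=> //; [split; [exact: (val1 Vp)|exact: (val0 Vp)]|by left|].
      by rewrite xE b0 rmorph1 rmorph0 !mul0r !addr0 mulr1.
    have [Oab|Oba] := val_total Vp (a / b).
      exists b, (a / b), 1; split=> //; [split=> //; exact: (val1 Vp)|by right|].
      by rewrite xE rmorph1 mul1r mulrDr -rmorphM /= [b * _]mulrC divfK.
    have [a0|a0] := eqVneq a 0.
      exists b, 0, 1; split=> //; [split; [exact: (val0 Vp)|exact: (val1 Vp)]|by right|].
      by rewrite xE a0 rmorph1 rmorph0 mul1r !add0r.
    exists a, 1, (b / a); split=> //; [|by left|].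
      split; first exact: (val1 Vp).
      by rewrite -invf_div -(divfK p0 (a / b)^-1); apply: (valM Vp) => //; apply: (val_pi Vp).
    by rewrite xE rmorph1 mulrDr mulr1 mulrA -rmorphM /= [a * _]mulrC divfK.
  pose N := a' ^+ 2 - W * b' ^+ 2.
  have nN : ~ pdiv N.
    move=> vN; have [va vb] := inert Oa' Ob' vN.
    apply: (vdiv1_neq1 Vp); by case: ab1 => e; move: va vb; rewrite e.
  have ONV : Op N^-1 by have [] := vdiv1_or_valV Vp N.
  have N0 : N != 0 by apply/eqP => N0; apply: nN; rewrite N0; apply: (vdiv0 Vp).
  have qu : qint (j a' + j b' * kap) by apply/qintE.
  have quV : qint (j a' + j b' * kap)^-1.
    have -> : (j a' + j b' * kap)^-1 = j (a' / N) + j (- b' / N) * kap.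
      have jN : j N = (j a' + j b' * kap) * (j a' - j b' * kap).
        by rewrite /N !expr2 rmorphB !rmorphM /= -kapE; ring.
      have jN0 : (j a' + j b' * kap) * (j a' - j b' * kap) != 0 by rewrite -jN fmorph_eq0.
      have := jN0; rewrite mulf_eq0 negb_or => /andP[u0 u0'].
      by rewrite !fmorph_div rmorphN /= jN; field; rewrite u0 u0'.
    by apply/qintE; split; apply: (valM Vp) => //; apply: (valN Vp).
  have [Oc|Oc] := val_total Vp c; [left|right]; rewrite xE'.
    by apply: qM => //; apply: qint_rat.
  rewrite invfM mulrAC jp -fmorphV -fmorph_div; apply: qM => //; exact: qint_rat.
- move=> x; have [a [b ->]] := F_spanned x => vx.
  have va : forall n, Op (a / p%:R ^+ n) /\ Op (b / p%:R ^+ n).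
    by move=> n; apply/qintE; rewrite -coord_divp.
  have a0 : a = 0 by apply: (val_sep Vp) => n; case: (va n).
  have b0 : b = 0 by apply: (val_sep Vp) => n; case: (va n).
  by rewrite a0 b0 rmorph0 mul0r addr0.
Qed.

Lemma qint_vdivE a b n :
  vdiv qint p%:R n (j a + j b * kap) <-> vdiv Op p%:R n a /\ vdiv Op p%:R n b.
Proof. by rewrite /vdiv coord_divp; apply: qintE. Qed.

(** For l = p the uniformizer is l itself, since p is inert; any other prime is a unit. *)
Lemma qint_vdiv_prime l n (x : F) : prime l ->
  vdiv qint p%:R n.+1 (l%:R * x) -> vdiv qint p%:R n x.
Proof.
move=> pl; have [-> |lp] := eqVneq l p.
  have jp0 : p%:R != 0 :> F by rewrite -(rmorph_nat j) fmorph_eq0.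
  by rewrite /vdiv exprS invfM mulrACA mulfV // mul1r.
have VF := qint_valuation_ring.
have l0 : l%:R != 0 :> F by rewrite -(rmorph_nat j) fmorph_eq0 pnatr_eq0 -lt0n prime_gt0.
move/(vdiv_unit VF l0) => v; apply: (vdiv_le VF (leqnSn n)); apply: v.
rewrite -(rmorph_nat j) -fmorphV; apply: qint_rat.
rewrite (pmulrn 1 l); apply: pintV; rewrite dvdzE /= dvdn_prime2 // eq_sym //.
Qed.

End QuadraticExtension.

(** * Residues modulo 5 *)

Lemma prime5 : prime 5. Proof. by []. Qed.

Lemma pint_residue_nat (p : nat) (x : rat) : prime p -> pint p x ->
  exists2 r : nat, (r < p)%N & vdiv (pint p) p%:R 1 (x - r%:R).
Proof.
move=> pp /(pint_residue pp)[n vn].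
have pz : p%:Z != 0 by rewrite eqz_nat -lt0n prime_gt0.
have [r rE] : exists r : nat, (n %% p)%Z = r%:Z.
  by exists `|(n %% p)%Z|%N; rewrite gez0_abs // modz_ge0.
exists r; first by rewrite -ltz_nat -rE ltz_pmod // ltz_nat prime_gt0.
have -> : x - r%:R = (x - n%:~R) + ((n %/ p)%Z * p)%:~R.
  by rewrite {1}(divz_eq n p) rE rmorphD /= -[r%:~R]pmulrn; ring.
apply: (vdivD (pint_valuation_ring pp)) => //.
by apply/(vdiv_int pp); rewrite dvdz_mull.
Qed.

(** 2 is not a square modulo 5, which is checked on the 25 pairs of residues. *)
Lemma inert5 (W a b : rat) : vdiv (pint 5) 5%:R 1 (W - 2) ->
  pint 5 a -> pint 5 b -> vdiv (pint 5) 5%:R 1 (a ^+ 2 - W * b ^+ 2) ->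
  vdiv (pint 5) 5%:R 1 a /\ vdiv (pint 5) 5%:R 1 b.
Proof.
move=> vW Oa Ob vN; have V5 := pint_valuation_ring prime5.
have [r r5 vr] := pint_residue_nat prime5 Oa; have [s s5 vs] := pint_residue_nat prime5 Ob.
have vrs : (5 %| r%:Z ^+ 2 - 2 * s%:Z ^+ 2)%Z.
  apply/(vdiv_int prime5).
  have -> : (r%:Z ^+ 2 - 2 * s%:Z ^+ 2)%:~R = (a ^+ 2 - W * b ^+ 2)
      - (a + r%:R) * (a - r%:R) + W * (b + s%:R) * (b - s%:R) + (W - 2) * s%:R ^+ 2.
    by rewrite !expr2 rmorphB !rmorphM /= -!pmulrn; ring.
  have Or n := val_nat V5 n.
  have OW : pint 5 W by rewrite -(subrK 2 W); apply: (valD V5) (vdivO V5 vW) (Or 2%N).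
  apply: (vdivD V5); last by apply: (vdivMr V5) => //; apply: (valX V5).
  apply: (vdivD V5); last first.
    by apply: (vdivMl V5) => //; apply: (valM V5) => //; apply: (valD V5).
  by apply: (vdivB V5) => //; apply: (vdivMl V5) => //; apply: (valD V5).
have chk : all (fun r => all (fun s =>
    (5 %| r%:Z ^+ 2 - 2 * s%:Z ^+ 2)%Z ==> ((r == 0%N) && (s == 0%N)))
  (iota 0 5)) (iota 0 5) by vm_compute.
have r_in : r \in iota 0 5 by rewrite mem_iota.
have s_in : s \in iota 0 5 by rewrite mem_iota.
have := allP (allP chk r r_in) s s_in; rewrite /=.
rewrite vrs => /andP[/eqP r0 /eqP s0].
by move: vr vs; rewrite r0 s0 !subr0.
Qed.

(* A pair (u1, u2) stands for u1 + u2 kappa in F_25, where kappa^2 = 2. *)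
Definition add25 (u v : int * int) := (u.1 + v.1, u.2 + v.2).
Definition mul25 (u v : int * int) := (u.1 * v.1 + 2 * (u.2 * v.2), u.1 * v.2 + u.2 * v.1).
Definition zero25 (u : int * int) := (5 %| u.1)%Z && (5 %| u.2)%Z.

Section Residues.
Variables (F : fieldType) (j : {rmorphism rat -> F}) (kap : F) (W : rat).
Hypotheses (kapE : kap ^+ 2 = j W) (W2 : vdiv (pint 5) 5%:R 1 (W - 2)).
Hypothesis F_spanned : forall x : F, exists a b : rat, x = j a + j b * kap.

Let V5 := pint_valuation_ring prime5.
Lemma pint_W : pint 5 W.
Proof. by rewrite -(subrK 2 W); apply: (valD V5) (vdivO V5 W2) (val_nat V5 2). Qed.

Local Notation O := (qint j kap 5).
Local Notation vdiv1 := (vdiv O 5%:R 1).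

Lemma qint5_valuation_ring : valuation_ring O 5%:R.
Proof. apply: (qint_valuation_ring prime5 kapE pint_W F_spanned); by move=> a b; apply: inert5. Qed.


Let VO := qint5_valuation_ring.

Definition lift25 (u : int * int) : F := u.1%:~R + u.2%:~R * kap.
Definition res25 (x : F) (u : int * int) : Prop := vdiv1 (x - lift25 u).

Lemma lift25E u : lift25 u = j u.1%:~R + j u.2%:~R * kap.
Proof. by rewrite !rmorph_int. Qed.

Lemma vdiv_lift25 u : vdiv1 (lift25 u) <-> zero25 u.
Proof.
rewrite lift25E (qint_vdivE prime5 kapE pint_W _) ?(vdiv_int prime5); last first.
  by move=> a b; apply: inert5.
by rewrite /zero25; split=> [[-> ->]|/andP[]].
Qed.

Lemma qint_lift25 u : O (lift25 u).
Proof.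
rewrite lift25E; exists u.1%:~R, u.2%:~R.
by split=> //; apply: (pint_int prime5).
Qed.

Lemma res25_O x u : res25 x u -> O x.
Proof.
move=> xu; rewrite -(subrK (lift25 u) x).
by apply: (valD VO) (vdivO VO xu) (qint_lift25 u).
Qed.

Lemma res25_add x y u v : res25 x u -> res25 y v -> res25 (x + y) (add25 u v).
Proof.
move=> xu yv; rewrite /res25.
have -> : x + y - lift25 (add25 u v) = (x - lift25 u) + (y - lift25 v).
  by rewrite /lift25 /add25 /= !rmorphD /=; ring.
exact: (vdivD VO).
Qed.

Lemma res25_mul x y u v : res25 x u -> res25 y v -> res25 (x * y) (mul25 u v).
Proof.
move=> xu yv; rewrite /res25.
(* The last term is the error from using 2 for kappa^2 = W. *)
have -> : x * y - lift25 (mul25 u v) = (x - lift25 u) * y + lift25 u * (y - lift25 v)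
    + u.2%:~R * v.2%:~R * j (W - 2).
  rewrite /lift25 /mul25 /= rmorphB /= -kapE !rmorphD !rmorphM !rmorph_nat /=; ring.
have Oi n : O n%:~R by rewrite -(rmorph_int j); apply: qint_rat => //; apply: (pint_int prime5).
apply: (vdivD VO); [apply: (vdivD VO)|].
- by apply: (vdivMr VO) => //; apply: res25_O yv.
- by apply: (vdivMl VO) => //; apply: qint_lift25.
- apply: (vdivMl VO); first exact: (valM VO).
  have -> : j (W - 2) = j (W - 2) + j 0 * kap by rewrite rmorph0 mul0r addr0.
  apply/(qint_vdivE prime5 kapE pint_W); first by move=> a b; apply: inert5.
  by split=> //; apply: (vdiv0 V5).
Qed.

Lemma res25_int n : res25 n%:~R (n, 0).
Proof. by rewrite /res25 /lift25 /= mul0r addr0 subrr; apply: (vdiv0 VO). Qed.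

Lemma res25_1 : res25 1 (1, 0). Proof. exact: (res25_int 1). Qed.

Lemma res25_opp x u : res25 x u -> res25 (- x) (mul25 (-1, 0) u).
Proof.
have -> : - x = (-1)%:~R * x by rewrite mulrN1z mulN1r.
exact/res25_mul/res25_int.
Qed.

Lemma res25_vdiv x u : res25 x u -> vdiv1 x <-> zero25 u.
Proof.
move=> xu; rewrite -vdiv_lift25; split=> h.
  have -> : lift25 u = x - (x - lift25 u) by ring.
  exact: (vdivB VO).
by rewrite -(subrK (lift25 u) x); apply: (vdivD VO).
Qed.

Lemma res25_unit x u : res25 x u -> ~~ zero25 u -> x != 0 /\ O x^-1.
Proof.
move=> xu /negP nu; have [vx|Ox] := vdiv1_or_valV VO x.
  by case: nu; apply/(res25_vdiv xu).
split=> //; apply/eqP => x0; apply: nu; apply/(res25_vdiv xu); rewrite x0.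
exact: (vdiv0 VO).
Qed.

Lemma res25_ex x : O x -> exists r s : nat,
  [/\ (r < 5)%N, (s < 5)%N & res25 x (r%:Z, s%:Z)].
Proof.
move=> [a [b [Oa Ob ->]]].
have [r r5 vr] := pint_residue_nat prime5 Oa; have [s s5 vs] := pint_residue_nat prime5 Ob.
exists r, s; split=> //; rewrite /res25 lift25E /= -!pmulrn.
have -> : j a + j b * kap - (j r%:R + j s%:R * kap) = j (a - r%:R) + j (b - s%:R) * kap.
  by rewrite !rmorphB /=; ring.
by apply/(qint_vdivE prime5 kapE pint_W); first by move=> c d; apply: inert5.
Qed.

End Residues.

(** * The curve of a triple and its good reduction *)

Section Triple.
Variables (F : fieldType) (a b c : F).
Hypotheses (two_neq0 : 2 != 0 :> F) (a0 : a != 0) (b0 : b != 0) (c0 : c != 0)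
  (ab : a != b) (ac : a != c) (bc : b != c).

Lemma triple_cubE x :
  cub (a * b * c) (a * b + a * c + b * c) (a + b + c) 1 x =
    (a * x + 1) * (b * x + 1) * (c * x + 1).
Proof. by rewrite /cub; ring. Qed.

Lemma triple_dcubE x :
  dcub (a * b * c) (a * b + a * c + b * c) (a + b + c) x =
    a * (b * x + 1) * (c * x + 1) + (a * x + 1) * b * (c * x + 1)
    + (a * x + 1) * (b * x + 1) * c.
Proof. by rewrite /dcub; ring. Qed.

Lemma triple_k_neq0 : a * b * c != 0.
Proof. by rewrite !mulf_neq0. Qed.

Lemma triple_smooth x :
  cub (a * b * c) (a * b + a * c + b * c) (a + b + c) 1 x = 0 ->
  dcub (a * b * c) (a * b + a * c + b * c) (a + b + c) x != 0.
Proof.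
have nocommon (u v : F) : u != v -> u * x + 1 = 0 -> v * x + 1 != 0.
  move=> uv u1; apply: contra_neq uv => v1.
  by lincomb (- v *e u1 +e u *e v1).
rewrite triple_cubE triple_dcubE => /eqP; rewrite !mulf_eq0 -orbA.
case/or3P=> /eqP e; rewrite e ?(mul0r, mulr0, addr0, add0r) !mulf_neq0 //;
  exact: nocommon e || (apply: nocommon e; by rewrite // eq_sym).
Qed.

Definition triple_curve : curve F := Curve two_neq0 triple_k_neq0 triple_smooth.

End Triple.

Section TripleGoodReduction.
Variables (F : fieldType) (O : F -> Prop) (pi : F).
Hypothesis VO : valuation_ring O pi.
Local Notation vdiv1 := (vdiv O pi 1).

Lemma no_common_root_red (u v x : F) : O u -> O v -> u - v != 0 -> O (u - v)^-1 ->
  vdiv1 (u * x + 1) -> ~ vdiv1 (v * x + 1).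
Proof.
move=> Ou Ov uv uvV vu vv; apply: (unit_neq_vdiv1 VO uv uvV).
have -> : u - v = u * (v * x + 1) - v * (u * x + 1) by ring.
by apply: (vdivB VO); apply: (vdivMl VO).
Qed.

Lemma triple_smooth_red (a b c x : F) :
  O a -> O b -> O c -> O x ->
  a != 0 -> b != 0 -> c != 0 -> a - b != 0 -> a - c != 0 -> b - c != 0 ->
  O a^-1 -> O b^-1 -> O c^-1 -> O (a - b)^-1 -> O (a - c)^-1 -> O (b - c)^-1 ->
  vdiv1 (cub (a * b * c) (a * b + a * c + b * c) (a + b + c) 1 x) ->
  ~ vdiv1 (dcub (a * b * c) (a * b + a * c + b * c) (a + b + c) x).
Proof.
have O1 := val1 VO.
(* The derivative arranged around the factor u x + 1 that vanishes in the residue field: only u (v x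
   + 1) (w x + 1) survives there, a product of units. *)
have half u v w : O u -> O v -> O w -> O x -> u != 0 -> O u^-1 ->
    u - v != 0 -> O (u - v)^-1 -> u - w != 0 -> O (u - w)^-1 ->
    vdiv1 (u * x + 1) -> ~ vdiv1 (u * ((v * x + 1) * (w * x + 1))
       + (u * x + 1) * (v * (w * x + 1) + w * (v * x + 1))).
  move=> Ou Ov Ow Ox u0 uV uv uvV uw uwV vu vd.
  have : vdiv1 (u * ((v * x + 1) * (w * x + 1))).
    rewrite -[X in vdiv1 X](addrK ((u * x + 1) * (v * (w * x + 1) + w * (v * x + 1)))).
    by apply: (vdivB VO) => //; apply: (vdivMr VO) => //; apply: (valD VO); apply: (valM VO) => //;
       apply: (valD VO) => //; apply: (valM VO).
  have Ovx : O (v * x + 1) by apply: (valD VO) => //; apply: (valM VO).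
  have Owx : O (w * x + 1) by apply: (valD VO) => //; apply: (valM VO).
  move/(vdiv_unit VO u0 uV)/(vdiv1_prime VO Ovx Owx) => [].
  - exact: (no_common_root_red Ou Ov).
  - exact: (no_common_root_red Ou Ow).
move=> Oa Ob Oc Ox a0 b0 c0 ab ac bc aV bV cV abV acV bcV.
have ba : b - a != 0 by rewrite -opprB oppr_eq0.
have ca : c - a != 0 by rewrite -opprB oppr_eq0.
have cb : c - b != 0 by rewrite -opprB oppr_eq0.
have baV : O (b - a)^-1 by rewrite -opprB invrN; apply: (valN VO).
have caV : O (c - a)^-1 by rewrite -opprB invrN; apply: (valN VO).
have cbV : O (c - b)^-1 by rewrite -opprB invrN; apply: (valN VO).
have Olin u : O u -> O (u * x + 1) by move=> Ou; apply: (valD VO) => //; apply: (valM VO).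
have Oax := Olin a Oa; have Obx := Olin b Ob; have Ocx := Olin c Oc.
rewrite triple_cubE triple_dcubE => vabc.
have [vab|vc] := vdiv1_prime VO (valM VO Oax Obx) Ocx vabc; last first.
  move: (half c a b Oc Oa Ob Ox c0 cV ca caV cb cbV vc).
  by congr (~ vdiv1 _); ring.
have [va|vb] := vdiv1_prime VO Oax Obx vab.
  move: (half a b c Oa Ob Oc Ox a0 aV ab abV ac acV va).
  by congr (~ vdiv1 _); ring.
move: (half b a c Ob Oa Oc Ox b0 bV ba baV bc bcV vb).
by congr (~ vdiv1 _); ring.
Qed.

End TripleGoodReduction.

(** * Counting residue classes of points over F_25 *)

(* The residues of a, b, c are 2 kappa, 1 + 3 kappa and -1 + 3 kappa. *)
Definition tcub25 (x : int * int) : int * int :=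
  mul25 (mul25 (add25 (mul25 (0, 2) x) (1, 0)) (add25 (mul25 (1, 3) x) (1, 0)))
    (add25 (mul25 (-1, 3) x) (1, 0)).

Definition oncurve25 (q : (nat * nat) * (nat * nat)) : bool :=
  let x := (q.1.1%:Z, q.1.2%:Z) in let y := (q.2.1%:Z, q.2.2%:Z) in
  zero25 (add25 (mul25 y y) (mul25 (-1, 0) (tcub25 x))).

Definition f25 : seq (nat * nat) := [seq (r, s) | r <- iota 0 5, s <- iota 0 5].
Definition pts25 := [seq q <- [seq (x, y) | x <- f25, y <- f25] | oncurve25 q].

Lemma size_pts25 : size pts25 = 19%N.
Proof. by vm_compute. Qed.

Lemma mem_pts25 r s r' s' : (r < 5)%N -> (s < 5)%N -> (r' < 5)%N -> (s' < 5)%N ->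
  oncurve25 ((r, s), (r', s')) -> ((r, s), (r', s')) \in pts25.
Proof.
move=> r5 s5 r'5 s'5 onq; rewrite mem_filter onq.
have f5 m n : (m < 5)%N -> (n < 5)%N -> (m, n) \in f25.
  by move=> m5 n5; apply/allpairsP; exists (m, n); rewrite !mem_iota.
by apply/allpairsP; exists ((r, s), (r', s')); rewrite !f5.
Qed.

(* Keeps simplification and conversion from enumerating the points again. *)
Opaque pts25.

Definition codes : seq (option ((nat * nat) * (nat * nat))) := None :: map Some pts25.

Lemma size_cons_map_Some (T : Type) (s : seq T) n :
  size s = n -> size (None :: map Some s) = n.+1.
Proof. by rewrite /= size_map => ->. Qed.

Lemma size_codes : size codes = 20%N.
Proof. exact: size_cons_map_Some size_pts25. Qed.

Lemma mem_codes_None : None \in codes. Proof. exact: mem_head. Qed.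

Lemma mem_codes_Some q : q \in pts25 -> Some q \in codes.
Proof. by move=> qin; rewrite in_cons; apply/orP; right; apply: map_f. Qed.

Opaque codes.

Section Count.
Variables (F : fieldType) (j : {rmorphism rat -> F}) (kap : F) (W : rat).
Hypotheses (kapE : kap ^+ 2 = j W) (W2 : vdiv (pint 5) 5%:R 1 (W - 2)).
Hypothesis F_spanned : forall x : F, exists a b : rat, x = j a + j b * kap.
Local Notation O := (qint j kap 5).
Local Notation res := (res25 j kap).
Variables a b c : F.
Hypotheses (two_neq0 : 2 != 0 :> F) (a0 : a != 0) (b0 : b != 0) (c0 : c != 0)
  (ab : a != b) (ac : a != c) (bc : b != c).
Hypotheses (ra : res a (0, 2)) (rb : res b (1, 3)) (rc : res c (-1, 3)).
Let E := triple_curve two_neq0 a0 b0 c0 ab ac bc.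
Let VO := qint5_valuation_ring kapE W2 F_spanned.

(** [None] encodes the whole kernel of reduction. This is a relation because integrality is only a
    proposition; codes are chosen later, for finitely many points at once. *)
Definition code (P : pt F) (o : option ((nat * nat) * (nat * nat))) : Prop :=
  match P, o with
  | Some (x, y), Some q => [/\ O x, O y, res x (q.1.1%:Z, q.1.2%:Z)
                            & res y (q.2.1%:Z, q.2.2%:Z)]
  | _, None => in_ker O 5%:R 1 P
  | _, _ => False
  end.

Lemma code_cong P Q o : code P o -> code Q o -> cong_pt O 5%:R P Q.
Proof.
case: o => [q|]; last by case: P Q => [[x y]|] [[x' y']|] //= kP kQ; left.
case: P Q => [[x y]|] [[x' y']|] //= [Ox Oy rx ry] [Ox' Oy' rx' ry']; right.
exists x, y, x', y'; split=> //; split.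
  rewrite -(subrKA (lift25 kap (q.1.1%:Z, q.1.2%:Z))); apply: (vdivD VO) => //.
  by rewrite -opprB; apply: (vdivN VO).
rewrite -(subrKA (lift25 kap (q.2.1%:Z, q.2.2%:Z))); apply: (vdivD VO) => //.
by rewrite -opprB; apply: (vdivN VO).
Qed.

Let res_lin u v x t : res v u -> res x t -> res (v * x + 1) (add25 (mul25 u t) (1, 0)).
Proof.
move=> rv rx; apply: (res25_add kapE W2 F_spanned); last exact: (res25_1 kapE W2 F_spanned).
exact: (res25_mul kapE W2 F_spanned).
Qed.

Let unit_of u x : res x u -> ~~ zero25 u -> [/\ O x, x != 0 & O x^-1].
Proof.
move=> rx nu; have [x0 xV] := res25_unit kapE W2 F_spanned rx nu.
by split=> //; apply: (res25_O kapE W2 F_spanned rx).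
Qed.

Let res_sub u v x y : res x u -> res y v -> res (x - y) (add25 u (mul25 (-1, 0) v)).
Proof.
move=> rx ry; apply: (res25_add kapE W2 F_spanned) => //.
exact: (res25_opp kapE W2 F_spanned).
Qed.

Lemma res_integral_point x y : y ^+ 2 = (a * x + 1) * (b * x + 1) * (c * x + 1) ->
  O x -> O y -> exists2 q, q \in pts25 & code (Some (x, y)) (Some q).
Proof.
move=> onP Ox Oy.
have [r [s [r5 s5 rx]]] := res25_ex kapE W2 Ox.
have [r' [s' [r'5 s'5 ry]]] := res25_ex kapE W2 Oy.
exists ((r, s), (r', s')) => //; apply: mem_pts25 => //.
pose u : int * int := (r%:Z, s%:Z); pose v : int * int := (r'%:Z, s'%:Z).
have rE : res (y * y - (a * x + 1) * (b * x + 1) * (c * x + 1))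
    (add25 (mul25 v v) (mul25 (-1, 0) (tcub25 u))).
  apply: res_sub; first exact: (res25_mul kapE W2 F_spanned).
  apply: (res25_mul kapE W2 F_spanned); last exact: res_lin.
  by apply: (res25_mul kapE W2 F_spanned); apply: res_lin.
apply/(res25_vdiv kapE W2 F_spanned rE).
by rewrite -expr2 onP subrr; apply: (vdiv0 VO).
Qed.

Let ua := unit_of ra isT.
Let ub := unit_of rb isT.
Let uc := unit_of rc isT.
Let Oa : O a. Proof. by case: ua. Qed.
Let Ob : O b. Proof. by case: ub. Qed.
Let Oc : O c. Proof. by case: uc. Qed.

Let Ok : O (ck E). Proof. by apply: (valM VO); first apply: (valM VO). Qed.
Let OkV : O (ck E)^-1.
Proof.
rewrite /= !invfM; case: ua ub uc => _ _ aV [_ _ bV] [_ _ cV].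
by apply: (valM VO); first apply: (valM VO).
Qed.
Let OA : O (cA E).
Proof. by apply: (valD VO); [apply: (valD VO)|]; apply: (valM VO). Qed.
Let OB : O (cB E).
Proof. by apply: (valD VO); first apply: (valD VO). Qed.
Let OC : O (cC E). Proof. exact: val1 VO. Qed.

Lemma code_ex (P : point E) : exists2 o, o \in codes & code (pval P) o.
Proof.
case: P => -[[x y]|] onP; last by exists None; [exact: mem_codes_None|].
have [Ox|nOx] := val_em VO x; last first.
  exists None; first exact: mem_codes_None.
  exact: (nonintegral_in_ker (E := E) VO OkV OA OB OC onP nOx).
move/eqP: (onP); rewrite triple_cubE => onP'.
have Oy : O y.
  apply: (val_sqrt VO); rewrite onP'; have O1 := val1 VO.
  by apply: (valM VO); [apply: (valM VO)|]; apply: (valD VO) => //; apply: (valM VO).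
have [q qin cq] := res_integral_point onP' Ox Oy.
by exists (Some q); first exact: mem_codes_Some.
Qed.

(** Distinct torsion points have distinct codes. The bound concerns finite families because of its
    use: one torsion point outside a subgroup Z/2 x Z/10 would give a family of 21. *)
Lemma torsion_card_le (T : finType) (f : T -> point E) :
  injective f -> (forall t, exists2 m, (0 < m)%N & f t *+ m = 0) -> (#|T| <= 20)%N.
Proof.
move=> f_inj f_tors.
have [g gP] : exists g, forall t, g t \in codes /\ code (pval (f t)) (g t).
  by apply: (fin_all_exists (P := fun t o => o \in codes /\ code (pval (f t)) o))
    => t; have [o oin co] := code_ex (f t); exists o.
have g_inj : injective g.
  move=> t t' gE; apply: f_inj.
  have [m m0 mf] := f_tors t; have [m' m'0 mf'] := f_tors t'.
  apply: (torsion_cong_eq VO Ok OkV OA OB OC _ _ _ m0 mf m'0 mf').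
  - move=> l n x; apply: (qint_vdiv_prime prime5 kapE (pint_W W2) F_spanned) => a' b'.
    exact: inert5.
  - have r2 : res 2 (2, 0) by apply: (res25_int kapE W2 F_spanned 2).
    by have [_ _] := unit_of r2 isT.
  - move=> x Ox; have [[_ _ aV] [_ _ bV] [_ _ cV]] := And3 ua ub uc.
    have [_ ab0 abV] := unit_of (res_sub ra rb) isT.
    have [_ ac0 acV] := unit_of (res_sub ra rc) isT.
    have [_ bc0 bcV] := unit_of (res_sub rb rc) isT.
    exact: (triple_smooth_red VO).
  - apply: code_cong (gP t).2 _; rewrite gE; exact: (gP t').2.
rewrite cardT -size_codes -[X in (X <= _)%N](size_map g); apply: uniq_leq_size.
  by rewrite map_inj_uniq // enum_uniq.
by move=> o /mapP[t _ ->]; case: (gP t).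
Qed.

End Count.

(** * Embedding Z/2 x Z/10 in an abelian group *)

Section Z2xZ10.
Variable G : zmodType.
Implicit Types x : G.

Lemma mulrn_mod x n m : x *+ n = 0 -> x *+ (m %% n) = x *+ m.
Proof. by move=> xn; rewrite {2}(divn_eq m n) mulrnDr mulnC mulrnA xn mul0rn add0r. Qed.

Lemma mulrn_coprime x m n : (0 < m)%N -> coprime m n -> x *+ m = 0 -> x *+ n = 0 -> x = 0.
Proof.
move=> m0 /eqP mn xm xn; case: (egcdnP n m0) => km kn e _.
have : x *+ (m * km) = x *+ (n * kn + gcdn m n) by rewrite mulnC e mulnC.
by rewrite mulrnDr !mulrnA xm xn !mul0rn add0r mn.
Qed.

Variables (P T1 T2 : G).
Hypotheses (P5 : P *+ 5 = 0) (P0 : P != 0) (T12 : T1 *+ 2 = 0) (T22 : T2 *+ 2 = 0).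
Hypotheses (T10 : T1 != 0) (T20 : T2 != 0) (T1T2 : T1 != T2).

Definition z2z10 (u : 'Z_2 * 'Z_10) : G := T2 *+ u.1 + (P + T1) *+ u.2.

Let R10 : (P + T1) *+ 10 = 0.
Proof.
have -> : 10%N = (5 * 2)%N by [].
by rewrite mulrnDl mulrnA P5 mul0rn add0r mulnC mulrnA T12 mul0rn.
Qed.

Lemma z2z10D u v : z2z10 (u + v) = z2z10 u + z2z10 v.
Proof.
rewrite /z2z10 /= !mulrn_mod // !mulrnDr; exact: addrACA.
Qed.

Lemma z2z10_inj : injective z2z10.
Proof.
suff ker u : z2z10 u = 0 -> u = 0.
  move=> u v uv; apply/eqP; rewrite -subr_eq0; apply/eqP/ker.
  by apply: (addIr (z2z10 v)); rewrite -z2z10D subrK add0r.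
case: u => i l; rewrite /z2z10 /= => e.
have x5 x : x *+ 2 = 0 -> x *+ 5 = x.
  by move=> x2; rewrite -(mulrn_mod 5 x2).
(* Multiplication by 5 kills P and fixes T1 and T2. What remains forces i = 0 and l even; then P *+
   l = 0 makes l a multiple of 5 as well. *)
have eT : T2 *+ i + T1 *+ l = 0.
  have : (T2 *+ i + (P + T1) *+ l) *+ 5 = 0 by rewrite e mul0rn.
  by rewrite mulrnDl (mulrnAC T2) (mulrnAC (P + T1)) (mulrnDl 5) P5 add0r !x5.
have [l_even i0] : ~~ odd l /\ i = 0.
  move: eT; rewrite -(mulrn_mod l T12) modn2.
  case: i {e} => -[|[|//]] i2; case: (odd l) => /=; rewrite ?mulr0n ?add0r ?addr0.
  - by move=> T1_0; case/eqP: T10.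
  - by move=> _; split=> //; apply/val_inj.
  - move=> e; case/eqP: T1T2; rewrite -[T1](addKr T2) e addr0.
    by apply/eqP; rewrite eq_sym -addr_eq0 -mulr2n T22.
  - by move=> T2_0; case/eqP: T20.
suff l0 : l = 0 by rewrite i0 l0.
have Pl : P *+ l = 0.
  move: e; rewrite i0 mulr0n add0r mulrnDl -(mulrn_mod l T12) modn2 (negPf l_even).
  by rewrite mulr0n addr0.
apply/eqP; apply: contraNeq P0 => l0; apply/eqP.
have [l5|l5] := boolP (5 %| l)%N; last first.
  by apply: (mulrn_coprime _ _ P5 Pl) => //; rewrite prime_coprime.
case: l l0 l5 l_even {e eT Pl} => -[|[|[|[|[|[|[|[|[|[|]]]]]]]]]] //=.
Qed.

Lemma z2z10_torsion u : z2z10 u *+ 10 = 0.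
Proof.
rewrite mulrnDl (mulrnAC (P + T1)) R10 mul0rn addr0 mulrnAC.
by rewrite -[10%N]/(2 * 5)%N mulrnA T22 !mul0rn.
Qed.

Lemma card_z2z10 : #|{: option ('Z_2 * 'Z_10)}| = 21%N.
Proof. by rewrite card_option card_prod !card_ord. Qed.

End Z2xZ10.

(** * The points of order 2 and 5 *)

Section TorsionTriple.
Variables (F : fieldType) (a b c : F).
Hypotheses (two_neq0 : 2 != 0 :> F) (a0 : a != 0) (b0 : b != 0) (c0 : c != 0)
  (ab : a != b) (ac : a != c) (bc : b != c).
(* The first equation makes the triple regular, hence Diophantine, with
   2 (0, 1) = - (1 / abc, _); the second one makes (0, 1) a point of order 5. *)
Hypotheses (regular : (a + b + c) ^+ 2 = 4 * (a * b + a * c + b * c + 1))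
  (order5 : 4 * (a * b * c) ^+ 2 + 2 * (a + b + c) * (a * b * c) = 1).
Let E := triple_curve two_neq0 a0 b0 c0 ab ac bc.
Let k := a * b * c.
Let k0 : k != 0. Proof. exact: triple_k_neq0. Qed.

Lemma triple_point_on x y : y ^+ 2 = (a * x + 1) * (b * x + 1) * (c * x + 1) ->
  oncurve (ck E) (cA E) (cB E) (cC E) (Some (x, y)).
Proof. by move=> e; rewrite /oncurve triple_cubE e. Qed.

Lemma triple_point01_on : 1 ^+ 2 = (a * 0 + 1) * (b * 0 + 1) * (c * 0 + 1).
Proof. by ring. Qed.
Definition triple_point01 : point E := Point (triple_point_on triple_point01_on).

Lemma triple_point2_on (u : F) : (a - u) * (b - u) * (c - u) = 0 -> u != 0 ->
  0 ^+ 2 = (a * (- u^-1) + 1) * (b * (- u^-1) + 1) * (c * (- u^-1) + 1).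
Proof.
move=> e u0; have linE v : v * (- u^-1) + 1 = - u^-1 * (v - u) by field.
by rewrite !linE; lincomb ((u^-1 ^+ 3) *e e).
Qed.

Lemma triple_point2_aE : (a - a) * (b - a) * (c - a) = 0. Proof. ring. Qed.
Lemma triple_point2_bE : (a - b) * (b - b) * (c - b) = 0. Proof. ring. Qed.

Definition triple_point2a : point E :=
  Point (triple_point_on (triple_point2_on triple_point2_aE a0)).
Definition triple_point2b : point E :=
  Point (triple_point_on (triple_point2_on triple_point2_bE b0)).

Lemma triple_point2_neq : triple_point2a != triple_point2b.
Proof.
apply/eqP => /(congr1 val) /= [] /oppr_inj/invr_inj.
exact/eqP.
Qed.

Lemma triple_point2a_order : triple_point2a *+ 2 = 0.
Proof. by apply/val_inj; rewrite mulr2n /= oppr0 !eqxx. Qed.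

Lemma triple_point2b_order : triple_point2b *+ 2 = 0.
Proof. by apply/val_inj; rewrite mulr2n /= oppr0 !eqxx. Qed.

(** With P = (0, 1) and lambda = (a + b + c) / 2, the tangent at P has slope lambda and, by
    [regular], meets the curve again at T with abscissa 1 / k. The tangent at T has slope 2 k +
    lambda and, by [order5], meets it again at -P. So 2 P = -T and 2 T = P, whence 4 P = -P. *)
Lemma triple_point01_order : triple_point01 *+ 5 = 0.
Proof.
have [lam lamE] : exists lam, 2 * lam = a + b + c.
  by exists ((a + b + c) / 2); field.
have lam2 : lam ^+ 2 = a * b + a * c + b * c + 1.
  apply: (mulfI (mulf_neq0 two_neq0 two_neq0)).
  by transitivity ((a + b + c) ^+ 2); [rewrite -lamE; ring|rewrite regular; ring].
have ord5 : 4 * k ^+ 2 + 4 * lam * k = 1.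
  by rewrite -[RHS]order5 -lamE /k; ring.
have c1 : col_on k (a * b + a * c + b * c) (a + b + c) 1 lam 1 0 1 0 1 k^-1 (1 + lam / k).
  split; split; rewrite ?lam2; [by ring|by ring|by field|by field|by rewrite -lamE; ring|by ring].
have c2 : col_on k (a * b + a * c + b * c) (a + b + c) 1 (2 * k + lam) (-1)
    k^-1 (1 + lam / k) k^-1 (1 + lam / k) 0 (-1).
  have kV : k^-1 = 4 * k + 4 * lam.
    by apply: (mulfI k0); rewrite mulfV // -[LHS]ord5; ring.
  split; split.
  - by field.
  - by field.
  - by ring.
  - transitivity (4 * k ^+ 2 + 4 * lam * k + lam ^+ 2); first ring.
    by rewrite ord5 lam2; field.
  - transitivity (2 * lam - k^-1); first by rewrite kV; ring.
    by rewrite lamE; field.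
  - by ring.
have onT : oncurve (ck E) (cA E) (cB E) (cC E) (Some (k^-1, 1 + lam / k)).
  by apply/eqP; apply: (col_on_curve c2).
pose T := Point onT.
have smo := triple_smooth a0 b0 c0 ab ac bc.
have PP : triple_point01 + triple_point01 = - T.
  by apply/val_inj; apply: (padd_col_on two_neq0 k0 smo c1).
have TT : T + T = triple_point01.
  by apply/val_inj; apply: (etrans (padd_col_on two_neq0 k0 smo c2)); rewrite opprK.
rewrite -[5%N]/(2 + 2 + 1)%N !mulrnDr mulr2n PP -opprD TT mulr1n addNr.
by [].
Qed.

End TorsionTriple.

(** * Q(kappa) as an abstract field *)

Definition quad (kap : algC) (x : algC) : Prop :=
  exists p q : rat, x = ratr p + ratr q * kap.

(** The curve arguments run over a [fieldType], so Q(kappa) is replaced by an abstract number field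
    embedded in [algC]. Horner's scheme and k^2 = W put every polynomial in k into the span of 1 and
    k. *)
Lemma quad_abstract (kap : algC) (W : rat) : kap ^+ 2 = ratr W ->
  exists (L : fieldType) (j : {rmorphism rat -> L}) (i : {rmorphism L -> algC}) (k : L),
  [/\ k ^+ 2 = j W, forall x, exists a b, x = j a + j b * k,
      i k = kap, forall r, i (j r) = ratr r & forall x, quad kap x <-> exists y, x = i y].
Proof.
move=> kapE; have [L [i [s]]] := num_field_exists [:: kap].
case: s => [|k [|]] // [ik] genL.
have [j jE] : exists j : {rmorphism rat -> L}, forall a, j a = a%:A by exists (in_alg L).
have ij a : i (j a) = ratr a := fmorph_eq_rat (i \o j) a.
have kE : k ^+ 2 = j W by apply: (fmorph_inj i); rewrite rmorphXn /= ik kapE ij.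
have Lspan : forall x, exists a b, x = j a + j b * k; last first.
  exists L, j, i, k; split=> // x; split=> [[p [q ->]]|[y ->]].
    by exists (j p + j q * k); rewrite rmorphD rmorphM ik !ij.
  have [p [q ->]] := Lspan y; exists p, q.
  by rewrite rmorphD rmorphM ik !ij.
move=> x; pose S x := exists a b, x = j a + j b * k.
have SD u v : S u -> S v -> S (u + v).
  move=> [a [b ->]] [a' [b' ->]]; exists (a + a'), (b + b').
  by rewrite !rmorphD /=; ring.
have Sk u : S u -> S (u * k).
  move=> [a [b ->]]; exists (b * W), a.
  by rewrite rmorphM /= -kE; ring.
have : x \in <<1; k>>%VS by rewrite -adjoin_seq1 genL memvf.
case/Fadjoin_polyP => p p1 ->; elim/poly_ind: p p1 => [|p c IHp] p1.
  by rewrite horner0; exists 0, 0; rewrite rmorph0 mul0r addr0.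
have cE m : (p * 'X + c%:P)`_m \in 1%VS by apply: (polyOverP p1).
rewrite hornerMXaddC; apply: SD.
  apply/Sk/IHp/polyOverP => m; have := cE m.+1.
  by rewrite coefD coefMX coefC /= addr0.
have := cE 0%N; rewrite coefD coefMX coefC /= add0r => /vlineP[r ->].
by exists r, 0; rewrite rmorph0 mul0r addr0 jE.
Qed.

(** * The triples over Q(kappa) *)

Section Coefficients.
Variables (W zeta : rat).
Local Notation pdiv := (vdiv (pint 5) 5%:R 1).
Hypotheses (zetaE : zeta ^+ 2 = 1 + W - W ^+ 2) (W2 : pdiv (W - 2)) (zeta2 : pdiv (zeta - 2)).

(* These make a = coef_a kappa, b, c = coef_b kappa +- coef_c the roots of a cubic
   subject to the relations [regular] and [order5] above; that this cubic splits
   over Q(kappa) is the equation zeta^2 = 1 + W - W^2. *)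
Definition coef_a := 2 * W / (1 - W ^+ 2).
Definition coef_b := (1 + W + W ^+ 2 - W ^+ 3) / (2 * W * (1 - W ^+ 2)).
Definition coef_c := zeta / (1 - W ^+ 2).

Let V5 := pint_valuation_ring prime5.
Let OW : pint 5 W. Proof. exact: pint_W W2. Qed.
Let Oi (n : int) : pint 5 n%:~R. Proof. exact: pint_int prime5 n. Qed.
Let On (n : nat) : pint 5 n%:R. Proof. exact: (pint_int prime5 n). Qed.
Let v5 : pdiv 5. Proof. exact/(vdiv_int prime5 5). Qed.

Let unit_cong (n : int) x : ~~ (5 %| n)%Z -> pdiv (x - n%:~R) -> x != 0 /\ pint 5 x^-1.
Proof.
move=> n5 vx; have nx : ~ pdiv x.
  move=> vx'; move/negP: n5; apply; apply/(vdiv_int prime5).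
  by rewrite -(subKr x n%:~R); apply: (vdivB V5).
split; last by have [] := vdiv1_or_valV V5 x.
by apply/eqP => x0; apply: nx; rewrite x0; apply: (vdiv0 V5).
Qed.

Lemma W_unit : W != 0 /\ pint 5 W^-1. Proof. exact: (unit_cong (n := 2)). Qed.
Lemma two_unit : pint 5 2^-1. Proof. exact: (pintV (p := 5) (n := 2%:Z) isT). Qed.

Lemma D_unit : 1 - W ^+ 2 != 0 /\ pint 5 (1 - W ^+ 2)^-1.
Proof.
apply: (unit_cong (n := -3)) => //.
have -> : 1 - W ^+ 2 - (-3)%:~R = - ((W + 2) * (W - 2)) by ring.
by apply: (vdivN V5); apply: (vdivMl V5) => //; apply: (valD V5).
Qed.

Lemma coef_a2 : pdiv (coef_a - 2).
Proof.
have [D0 DV] := D_unit.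
have -> : coef_a - 2 = 2 * ((W + 3) * (W - 2) + 5) / (1 - W ^+ 2) by rewrite /coef_a; field.
apply: (vdivMr V5) => //; apply: (vdivMl V5) => //.
by apply: (vdivD V5) => //; apply: (vdivMl V5) => //; apply: (valD V5).
Qed.

Let vW21 : pdiv (W ^+ 2 + 1).
Proof.
have -> : W ^+ 2 + 1 = (W + 2) * (W - 2) + 5 by ring.
by apply: (vdivD V5) => //; apply: (vdivMl V5) => //; apply: (valD V5).
Qed.

Lemma coef_b3 : pdiv (coef_b - 3).
Proof.
have [D0 DV] := D_unit; have [W0 WV] := W_unit.
have -> : coef_b - 3 = (W ^+ 2 + 1 + 5 * (W ^+ 3 - W)) * (2^-1 * W^-1 * (1 - W ^+ 2)^-1).
  by rewrite /coef_b; field; rewrite D0 W0.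
apply: (vdivMr V5); last by apply: (valM V5) => //; apply: (valM V5) => //; apply: two_unit.
apply: (vdivD V5) => //; apply: (vdivMr V5) => //.
by apply: (valB V5) => //; apply: (valX V5).
Qed.

Lemma coef_c1 : pdiv (coef_c - 1).
Proof.
have [D0 DV] := D_unit.
have -> : coef_c - 1 = (zeta - 2 + (W ^+ 2 + 1)) / (1 - W ^+ 2) by rewrite /coef_c; field.
by apply: (vdivMr V5) => //; apply: (vdivD V5).
Qed.

(** This and [coef_order5] are [regular] and [order5] with kappa^2 replaced by W, so that only
    rational numbers remain. There M stands for bc and simplifies to (1 - W)^2 / (4 W). *)
Lemma coef_regular :
  coef_a ^+ 2 * W - 4 * coef_a * coef_b * W + 4 * coef_c ^+ 2 = 4.
Proof.
have [D0 _] := D_unit; have [W0 _] := W_unit.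
have -> : coef_c ^+ 2 = (1 + W - W ^+ 2) / (1 - W ^+ 2) ^+ 2 by rewrite /coef_c expr_div_n zetaE.
by rewrite /coef_a /coef_b; field; rewrite D0 W0.
Qed.

Lemma coef_order5 (M := coef_b ^+ 2 * W - coef_c ^+ 2) :
  4 * coef_a ^+ 2 * W * M ^+ 2 + 2 * (coef_a + 2 * coef_b) * coef_a * W * M = 1.
Proof.
have [D0 _] := D_unit; have [W0 _] := W_unit; rewrite /M.
have -> : coef_c ^+ 2 = (1 + W - W ^+ 2) / (1 - W ^+ 2) ^+ 2 by rewrite /coef_c expr_div_n zetaE.
by rewrite /coef_a /coef_b; field; rewrite D0 W0.
Qed.

End Coefficients.

(** * Transfer of the group law to the complex algebraic numbers *)

Section Transfer.
Variables (L : fieldType) (i : {rmorphism L -> algC}) (a b c : L).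
Let k := a * b * c.
Let A := a * b + a * c + b * c.
Let B := a + b + c.

Definition emb (P : pt L) : ecpt := omap (fun xy => (i xy.1, i xy.2)) P.

Lemma emb_inj : injective emb.
Proof.
by move=> [[x y]|] [[x' y']|] //= [] /fmorph_inj-> /fmorph_inj->.
Qed.

Lemma emb_add P Q : emb (padd k A B P Q) = ec_add (i a) (i b) (i c) (emb P) (emb Q).
Proof.
case: P Q => [[x y]|] [[x' y']|] //=.
rewrite -rmorphN !(inj_eq (fmorph_inj i)).
case: ifP => // _.
set s := if x == x' then dcub k A B x / _ else _.
set S := if x == x' then ec_df _ _ _ _ / _ else _.
have <- : i s = S.
  rewrite /s /S; case: ifP => _; last by rewrite fmorph_div !rmorphB.
  rewrite fmorph_div; congr (_ / _); last by rewrite rmorphM rmorph_nat.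
  by rewrite /dcub /ec_df /k /A /B !(rmorphD, rmorphM, rmorphXn, rmorph_nat); ring.
have aE : (i k, i A) = (i a * i b * i c, i a * i b + i a * i c + i b * i c).
  by rewrite /k /A !rmorphD !rmorphM.
case: aE => <- <-.
have xE : i ((s ^+ 2 - A) / k - x - x') = (i s ^+ 2 - i A) / i k - i x - i x'.
  by rewrite !rmorphB fmorph_div rmorphB rmorphXn.
rewrite -xE /=; congr (Some (_, _)).
by rewrite rmorphN rmorphD rmorphM rmorphB.
Qed.

Lemma emb_iter n P :
  emb (iter n (padd k A B P) None) = ec_mul (i a) (i b) (i c) n (emb P).
Proof. by rewrite /ec_mul; elim: n => //= n <-; apply: emb_add. Qed.

Lemma emb_on_curve P : on_curve (i a) (i b) (i c) (emb P) <-> oncurve k A B 1 P.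
Proof.
case: P => [[x y]|] //=; rewrite /k /A /B triple_cubE.
have -> : ec_f (i a) (i b) (i c) (i x) = i ((a * x + 1) * (b * x + 1) * (c * x + 1)).
  by rewrite /ec_f !(rmorphM, rmorphD, rmorph1).
rewrite -rmorphXn; split=> [/fmorph_inj-> //|/eqP-> //].
Qed.

End Transfer.

Definition triple_of (kap : algC) (W zeta : rat) : algC * algC * algC :=
  let b := ratr (coef_b W) * kap in let c := ratr (coef_c W zeta) in
  (ratr (coef_a W) * kap, c + b, - c + b).

(** K is tied to kappa only by an equivalence, so that one field can serve all its generators r
    kappa met along the tripling sequence. *)
Theorem triple_of_torsion (K : algC -> Prop) (kap : algC) (W zeta : rat) :
  (forall x, K x <-> quad kap x) ->
  kap ^+ 2 = ratr W -> zeta ^+ 2 = 1 + W - W ^+ 2 ->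
  vdiv (pint 5) 5%:R 1 (W - 2) -> vdiv (pint 5) 5%:R 1 (zeta - 2) ->
  let: (a, b, c) := triple_of kap W zeta in
  dioph_triple K a b c /\ torsion_Z2xZ10 K a b c.
Proof.
move=> KE kapE zetaE W2 zeta2.
have [L [j [i [k [kE Lspan ik ij quadP']]]]] := quad_abstract kapE.
have quadP x : K x <-> exists y, x = i y by rewrite KE.
pose al := j (coef_a W); pose be := j (coef_b W); pose ga := j (coef_c W zeta).
pose a := al * k; pose b := ga + be * k; pose c := - ga + be * k.
have V5 := pint_valuation_ring prime5.
have resP p q (m n : int) : vdiv (pint 5) 5%:R 1 (p - m%:~R) ->
    vdiv (pint 5) 5%:R 1 (q - n%:~R) -> res25 j k (j p + j q * k) (m, n).
  move=> vp vq; rewrite /res25 (lift25E j) /=.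
  have -> : j p + j q * k - (j m%:~R + j n%:~R * k) = j (p - m%:~R) + j (q - n%:~R) * k.
    by rewrite !rmorphB /=; ring.
  by apply/(qint_vdivE prime5 kE (pint_W W2)); first by move=> ? ?; apply: inert5.
have va := coef_a2 W2; have vb := coef_b3 W2; have vc := coef_c1 W2 zeta2.
have ra : res25 j k a (0, 2).
  have -> : a = j 0 + j (coef_a W) * k by rewrite rmorph0 add0r.
  by apply: resP => //; rewrite subr0; apply: (vdiv0 V5).
have rb : res25 j k b (1, 3) by apply: resP.
have rc : res25 j k c (-1, 3).
  rewrite /c -rmorphN; apply: resP => //.
  by rewrite -opprB opprK addrC; apply: (vdivN V5).
have nz x u : res25 j k x u -> ~~ zero25 u -> x != 0.
  by move=> rx nu; have [] := res25_unit kE W2 Lspan rx nu.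
have a0 := nz _ _ ra isT; have b0 := nz _ _ rb isT; have c0 := nz _ _ rc isT.
have neq x y u v : res25 j k x u -> res25 j k y v ->
    ~~ zero25 (add25 u (mul25 (-1, 0) v)) -> x != y.
  move=> rx ry nu; rewrite -subr_eq0; apply: nz nu.
  by apply: (res25_add kE W2 Lspan) => //; apply: (res25_opp kE W2 Lspan).
have ab := neq _ _ _ _ ra rb isT; have ac := neq _ _ _ _ ra rc isT.
have bc := neq _ _ _ _ rb rc isT.
have two0 : 2 != 0 :> L by rewrite -(fmorph_eq0 i) rmorph_nat pnatr_eq0.
have Q1 : al ^+ 2 * j W - 4 * al * be * j W + 4 * ga ^+ 2 = 4.
  have := congr1 j (coef_regular zetaE W2); rewrite /al /be /ga.
  move: (coef_a W) (coef_b W) (coef_c W zeta) => p q r.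
  by rewrite !expr2 !(rmorph_nat, rmorphB, rmorphD, rmorphM).
pose M := be ^+ 2 * j W - ga ^+ 2.
have Q2 : 4 * al ^+ 2 * j W * M ^+ 2 + 2 * (al + 2 * be) * al * j W * M = 1.
  have := congr1 j (coef_order5 zetaE W2); rewrite /M /al /be /ga.
  move: (coef_a W) (coef_b W) (coef_c W zeta) => p q r.
  by rewrite !expr2 rmorph1 !(rmorph_nat, rmorphB, rmorphD, rmorphM).
have regular : (a + b + c) ^+ 2 = 4 * (a * b + a * c + b * c + 1).
  rewrite /a /b /c; lincomb (Q1 +e (al ^+ 2 - 4 * al * be) *e kE).
have pE : a * b * c = al * k * M.
  by rewrite /a /b /c /M; lincomb ((al * be ^+ 2 * k) *e kE).
have order5 : 4 * (a * b * c) ^+ 2 + 2 * (a + b + c) * (a * b * c) = 1.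
  rewrite pE /a /b /c.
  lincomb (Q2 +e (4 * al ^+ 2 * M ^+ 2 + 2 * (al + 2 * be) * al * M) *e kE).
have tE : triple_of kap W zeta = (i a, i b, i c).
  rewrite /triple_of /a /b /c /al /be /ga.
  move: (coef_a W) (coef_b W) (coef_c W zeta) => p q r.
  by rewrite !(rmorphD, rmorphM, rmorphN) ik !ij.
rewrite tE; have Ki x : K (i x) by apply/quadP; exists x.
have inz x : x != 0 -> i x != 0 by rewrite fmorph_eq0.
have ineq x y : x != y -> i x != i y by rewrite (inj_eq (fmorph_inj i)).
split.
  (* Regularity is symmetric and equivalent to 4 (x y + 1) = (z - x - y)^2. *)
  have sq x y z : (x + y + z) ^+ 2 = 4 * (x * y + x * z + y * z + 1) ->
      is_square_in K (i x * i y + 1).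
    move=> e; exists (i ((z - x - y) / 2)); split=> //.
    rewrite -rmorphM -(rmorph1 i) -rmorphD -rmorphXn; congr (i _).
    apply: (mulfI (mulf_neq0 two0 two0)).
    transitivity ((z - x - y) ^+ 2); last by field.
    by lincomb (-1 *e e).
  split; [by []|split; [by split; apply: inz|split; [by split; apply: ineq|split]]].
  - exact: (sq _ _ c).
  - by apply: (sq _ _ b); rewrite -addrA [c + b]addrC addrA regular; ring.
  - by apply: (sq _ _ a); rewrite addrC addrA regular; ring.
pose E := triple_curve two0 a0 b0 c0 ab ac bc.
pose P : point E := triple_point01 two0 a0 b0 c0 ab ac bc.
pose T1 : point E := triple_point2a two0 a0 b0 c0 ab ac bc.
pose T2 : point E := triple_point2b two0 a0 b0 c0 ab ac bc.
have P5 : P *+ 5 = 0 := triple_point01_order two0 a0 b0 c0 ab ac bc regular order5.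
have T12 : T1 *+ 2 = 0 := triple_point2a_order two0 a0 b0 c0 ab ac bc.
have T22 : T2 *+ 2 = 0 := triple_point2b_order two0 a0 b0 c0 ab ac bc.
have T1T2 : T1 != T2 := triple_point2_neq two0 a0 b0 c0 ab ac bc.
(* P, T1 and T2 are affine points, so they differ from 0 by computation. *)
have phi_inj : injective (z2z10 P T1 T2) := z2z10_inj P5 isT T12 T22 isT isT T1T2.
exists (fun u => emb i (pval (z2z10 P T1 T2 u))); split=> [u v /emb_inj/val_inj/phi_inj //|].
split=> [u v|Q].
  by rewrite (z2z10D P5 T12 T22) pvalD; apply: (emb_add i a b c).
split=> [[[onQ KQ] [n [n0 nQ]]]|[u <-]].
  have [X XE] : exists X : point E, emb i (pval X) = Q.
    case: Q onQ KQ {nQ} => [[x y]|] onQ KQ; last by exists 0.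
    case: KQ => /quadP[x' xE] /quadP[y' yE].
    have onX : oncurve (ck E) (cA E) (cB E) (cC E) (Some (x', y')).
      by apply/(emb_on_curve i a b c); rewrite -[emb _ _]/(Some (i x', i y')) -xE -yE.
    by exists (Point onX); rewrite xE yE.
  have nX : X *+ n = 0.
    apply/val_inj/(emb_inj (i := i)); rewrite -XE in nQ; rewrite -[RHS]nQ.
    by rewrite -(emb_iter i a b c) -[in RHS](pvalMn n X).
  case: (boolP [exists u, z2z10 P T1 T2 u == X]) => [/existsP[u /eqP uX]|/existsPn nX'].
    by exists u; rewrite uX.
  pose f o := if o is Some u then z2z10 P T1 T2 u else X.
  have f_inj : injective f.
    move=> [u|] [v|] //= e; first by rewrite (phi_inj _ _ e).
      by have := nX' u; rewrite e eqxx.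
    by have := nX' v; rewrite -e eqxx.
  have f_tors t : exists2 m, (0 < m)%N & f t *+ m = 0.
    case: t => [u|]; last by exists n.
    by exists 10%N => //; apply: (z2z10_torsion P5 T12 T22).
  by have := torsion_card_le kE W2 Lspan ra rb rc f_inj f_tors; rewrite card_z2z10.
split; last first.
  exists 10%N; split=> //.
  by rewrite -(emb_iter i a b c) -(pvalMn 10 (z2z10 P T1 T2 u)) (z2z10_torsion P5 T12 T22).
split; first by apply/(emb_on_curve i a b c); apply: (pvalP (z2z10 P T1 T2 u)).
by case: (pval _) => [[x y]|] //=.
Qed.

(** * Infinitely many triples and fields *)

Section UnitAt.
Variable p : nat.
Hypothesis p_prime : prime p.
Let Vp := pint_valuation_ring p_prime.
Let p0 : p%:R != 0 :> rat. Proof. by rewrite pnatr_eq0 -lt0n prime_gt0. Qed.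

(** This is the p-adic valuation of x being exactly e. *)
Definition unit_at (e : nat) (x : rat) : Prop :=
  [/\ x != 0, pint p (x / p%:R ^+ e) & pint p (p%:R ^+ e / x)].

Lemma unit_at0 x : x != 0 -> pint p x -> pint p x^-1 -> unit_at 0 x.
Proof. by move=> x0 Ox OxV; split; rewrite // ?expr0 ?divr1 ?mul1r. Qed.

Lemma unit_atM e e' x y : unit_at e x -> unit_at e' y -> unit_at (e + e') (x * y).
Proof.
move=> [x0 Ox xO] [y0 Oy yO]; split; first exact: mulf_neq0.
  by rewrite exprD invfM mulrACA; apply: (valM Vp).
by rewrite exprD invfM mulrACA; apply: (valM Vp).
Qed.

Lemma unit_at0V x : unit_at 0 x -> unit_at 0 x^-1.
Proof.
move=> [x0]; rewrite expr0 divr1 div1r => Ox OxV.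
by apply: unit_at0; rewrite ?invr_eq0 ?invrK.
Qed.

Lemma unit_atX e m x : unit_at e x -> unit_at (e * m) (x ^+ m).
Proof.
move=> ux; elim: m => [|m IHm]; last by rewrite exprS mulnS; apply: unit_atM.
by rewrite muln0 expr0; apply: unit_at0; rewrite ?oner_neq0 ?invr1 //; exact: val1 Vp.
Qed.

Lemma unit_at_int (n : int) : ~~ (p %| n)%Z -> unit_at 0 n%:~R.
Proof.
move=> pn; apply: unit_at0; [|exact: pint_int|exact: pintV].
by rewrite intr_eq0; apply: contraNneq pn => ->; rewrite dvdz0.
Qed.

Lemma unit_at_p : unit_at 1 p%:R.
Proof. by split; rewrite // expr1 mulfV //; exact: val1 Vp. Qed.

Lemma unit_at_sub1 t : vdiv (pint p) p%:R 1 t -> unit_at 0 (1 - t).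
Proof.
move=> vt; apply: unit_at0; [exact: one_sub_neq0 vt| |exact: one_sub_unit vt].
by apply: (valB Vp); [exact: val1 Vp|exact: vdivO vt].
Qed.

Lemma unit_at_le e e' x : unit_at e x -> unit_at e' x -> (e' <= e)%N.
Proof.
move=> [x0 Ox xO] [_ Ox' xO']; rewrite leqNgt; apply/negP => ee'.
apply: (val_piV Vp); have := valM Vp Ox' xO.
have -> : x / p%:R ^+ e' * (p%:R ^+ e / x) = (p%:R ^+ (e' - e))^-1.
  have := p0; rewrite -{1}(subnK (ltnW ee')) exprD => p00.
  by field; rewrite x0 !expf_neq0.
rewrite -(subnSK ee') exprS invfM => Op.
have -> : p%:R^-1 = p%:R^-1 * (p%:R ^+ (e' - e.+1))^-1 * p%:R ^+ (e' - e.+1) :> rat.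
  by rewrite mulfVK // expf_neq0.
by apply: (valM Vp) => //; apply: (valX Vp); apply: (val_pi Vp).
Qed.

Lemma unit_at_inj e e' x : unit_at e x -> unit_at e' x -> e = e'.
Proof. by move=> u u'; apply/eqP; rewrite eqn_leq !(@unit_at_le _ _ x). Qed.

Lemma unit_at_nonsquare (r : rat) : ~ unit_at 1 (r ^+ 2).
Proof.
move=> [r0 vr rO].
have v1 : vdiv (pint p) p%:R 1 (r ^+ 2) by [].
have vr1 := vdiv1_sqrt Vp (val_sqrt Vp (vdivO Vp v1)) v1.
have v2 : vdiv (pint p) p%:R 2 (r ^+ 2) by apply: (vdivX Vp 2 vr1).
apply: (val_piV Vp); have := valM Vp v2 rO.
by have -> : r ^+ 2 / p%:R ^+ 2 * (p%:R ^+ 1 / r ^+ 2) = p%:R^-1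
  by field; rewrite p0 -sqrf_eq0 r0.
Qed.

Lemma unit_at_ex (n : nat) : (0 < n)%N -> exists e, unit_at e n%:R.
Proof.
move=> n0; exists (logn p n); have [m pm nE] := pfactor_coprime p_prime n0.
move: nE; set e := logn p n => ->; rewrite natrM mulrC -[X in unit_at X]addn0.
apply: unit_atM.
  by rewrite natrX -[X in unit_at X]mul1n; apply: unit_atX; apply: unit_at_p.
by apply: (unit_at_int (n := m)); rewrite dvdzE /= -prime_coprime.
Qed.

End UnitAt.

(* With x = 1 / W, the curve zeta^2 = 1 + W - W^2 becomes the elliptic curve
   W y^2 = x^3 + x^2 - x after the twist y = zeta / W^2, and tripling sends x to
   x trip_den(W)^2 / trip_num(W)^2. *)
Definition trip_num (W : rat) := 3 + 4 * W - 6 * W ^+ 2 - W ^+ 4.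
Definition trip_den (W : rat) := 1 + 6 * W ^+ 2 + 4 * W ^+ 3 - 3 * W ^+ 4.
Definition trip_zeta (W : rat) :=
  1 + 4 * W - 28 * W ^+ 2 - 28 * W ^+ 3 - 10 * W ^+ 4 + 28 * W ^+ 5
  - 28 * W ^+ 6 - 4 * W ^+ 7 + W ^+ 8.

Definition rho W := trip_num W / trip_den W.
Definition zfac W := trip_zeta W / trip_den W ^+ 2.

Record good (e : nat) (W zeta : rat) : Prop := {
  good_curve : zeta ^+ 2 = 1 + W - W ^+ 2;
  good_W5 : vdiv (pint 5) 5%:R 1 (W - 2);
  good_zeta5 : vdiv (pint 5) 5%:R 1 (zeta - 2);
  good_W3 : unit_at 3 e W }.

Lemma prime3 : prime 3. Proof. by []. Qed.

Section Step.
Variables (e : nat) (W zeta : rat).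
Hypotheses (gW : good e W zeta) (e2 : (1 < e)%N).
Let V5 := pint_valuation_ring prime5.
Let V3 := pint_valuation_ring prime3.
Local Notation vdiv5 := (vdiv (pint 5) 5%:R 1).
Local Notation vdiv3 := (vdiv (pint 3) 3%:R 1).
Let O5W : pint 5 W := pint_W (good_W5 gW).

(* Every integer polynomial q satisfies q(W) = q(2) modulo 5; here q is given
   with its quotient by X - 2. *)
Let cong5 x q (n : int) : pint 5 q -> x = (W - 2) * q + n%:~R -> (5 %| n)%Z -> vdiv5 x.
Proof.
move=> Oq -> n5; apply: (vdivD V5); last exact/(vdiv_int prime5).
by apply: (vdivMr V5) => //; apply: good_W5 gW.
Qed.

Ltac pint5 := repeat match goal with
  | |- pint _ (_ + _) => apply: (valD V5)
  | |- pint _ (- _) => apply: (valN V5)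
  | |- pint _ (_ * _) => apply: (valM V5)
  | |- pint _ (_ ^+ _) => apply: (valX V5)
  | |- pint _ 1 => exact: (val1 V5)
  | |- pint _ _%:R => exact: (val_nat V5)
  | |- pint _ W => exact: O5W
  end.

Lemma den5 : trip_den W != 0 /\ pint 5 (trip_den W)^-1.
Proof.
have v : vdiv5 (trip_den W - 4).
  apply: (cong5 (q := - 3 * W ^+ 3 - 2 * W ^+ 2 + 2 * W + 4) (n := 5)); [by pint5| |by []].
  by rewrite /trip_den; ring.
have n4 : ~ vdiv5 4 by move/(vdiv_int prime5 4).
have nD : ~ vdiv5 (trip_den W).
  move=> vD; apply: n4; rewrite -(subKr (trip_den W) 4); exact: (vdivB V5).
split; last by have [] := vdiv1_or_valV V5 (trip_den W).
by apply/eqP => D0; apply: nD; rewrite D0; apply: (vdiv0 V5).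
Qed.

(** Modulo 5 a point with W = 2 doubles to x = 0, the point (0, 0), so it has order 4 and its triple
    is its negative; this is why tripling keeps W modulo 5, while doubling does not. Negation sends
    kappa to -kappa and fixes zeta, whence [rho W] = -1 and [zfac W] = 1 modulo 5. At 3, W behaves
    like the square of the formal parameter at infinity, which tripling multiplies by 3: [rho] takes
    the value 3 at W = 0. *)
Lemma good_step : good e.+2 (W * rho W ^+ 2) (zeta * zfac W).
Proof.
have [D0 DV] := den5; split.
- rewrite exprMn (good_curve gW) /zfac /rho.
  move: D0; rewrite /trip_den /trip_num /trip_zeta => D0.
  by field.
- have vr : vdiv5 (rho W + 1).
    have -> : rho W + 1 = (trip_num W + trip_den W) / trip_den W 
      by rewrite /rho; move: (trip_num W) (trip_den W) D0 => x y y0; field.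
    apply: (vdivMr V5) => //.
    apply: (cong5 (q := - 4 * W ^+ 3 - 4 * W ^+ 2 - 8 * W - 12) (n := -20)); [by pint5| |by []].
    by rewrite /trip_num /trip_den; ring.
  have -> : W * rho W ^+ 2 - 2 = (W - 2) + W * (rho W - 1) * (rho W + 1).
    by move: (rho W) => r; ring.
  apply: (vdivD V5); first exact: good_W5 gW.
  apply: (vdivMl V5) => //; apply: (valM V5) => //; rewrite /rho /trip_num.
  by pint5.
- have vz : vdiv5 (zfac W - 1).
    have -> : zfac W - 1 = (trip_zeta W - trip_den W ^+ 2) / trip_den W ^+ 2.
      by rewrite /zfac; move: (trip_zeta W) (trip_den W) D0 => x y y0; field.
    apply: (vdivMr V5); last by rewrite -exprVn; apply: (valX V5).
    apply: (cong5 (q := - 860 - 432 * W - 196 * W ^+ 2 - 80 * W ^+ 3 - 20 * W ^+ 4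
      + 4 * W ^+ 6 - 8 * W ^+ 7) (n := -1720)); [by pint5| |by []].
    by rewrite /trip_zeta /trip_den; ring.
  have -> : zeta * zfac W - 2 = (zeta - 2) + zeta * (zfac W - 1).
    by move: (zfac W) => z; ring.
  apply: (vdivD V5); first exact: good_zeta5 gW.
  apply: (vdivMl V5) => //.
  rewrite -(subrK 2 zeta); apply: (valD V5) (val_nat V5 2).
  exact: vdivO (good_zeta5 gW).
have [W0 vW _] := good_W3 gW.
have v2 : vdiv (pint 3) 3%:R 2 W by apply: vdiv_le e2 vW.
pose X := W / 9.
have OX : pint 3 X by [].
have WE : W = 9 * X by rewrite /X; field.
have O3W : pint 3 W by apply: vdivO v2.
have O3 n : pint 3 n%:R by exact: val_nat V3 n.
have v3 x : pint 3 x -> vdiv3 (3 * x) by rewrite /vdiv expr1 mulrC mulKf.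
(* Here e > 1 matters: 9 divides W, so the term 4 W cannot cancel the constant 3 of [trip_num]. *)
have uN : unit_at 3 1 (trip_num W).
  have -> : trip_num W = 3 * (1 - 3 * (X * (W ^+ 3 + 6 * W - 4))).
    by rewrite /trip_num [in RHS]mulrBr; rewrite WE; ring.
  apply: (unit_atM prime3 (e := 1) (e' := 0)); first exact: unit_at_p.
  apply: (unit_at_sub1 prime3); apply: v3; apply: (valM V3) => //.
  apply: (valB V3) => //; apply: (valD V3); first exact: (valX V3).
  exact: (valM V3).
have uD : unit_at 3 0 (trip_den W).
  have -> : trip_den W = 1 - 3 * (X * (3 * (3 * W ^+ 3 - 4 * W ^+ 2 - 6 * W))).
    by rewrite /trip_den WE; ring.
  apply: (unit_at_sub1 prime3); apply: v3; apply: (valM V3) => //; apply: (valM V3) => //.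
  apply: (valB V3); [apply: (valB V3)|]; apply: (valM V3) => //; exact: (valX V3).
have -> : e.+2 = (e + 1 * 2)%N by rewrite muln2 addn2.
apply: (unit_atM prime3); first exact: good_W3 gW.
apply: (unit_atX prime3); apply: (unit_atM prime3 (e := 1) (e' := 0)) => //.
exact: unit_at0V.
Qed.

End Step.

(** * Quadratic fields and their square classes *)

Section QuadraticField.
Variables (kap : algC) (W : rat).
Hypotheses (kapE : kap ^+ 2 = ratr W) (W5 : vdiv (pint 5) 5%:R 1 (W - 2)).

Lemma quad_coord_inj (a b a' b' : rat) :
  ratr a + ratr b * kap = ratr a' + ratr b' * kap -> a = a' /\ b = b'.
Proof.
apply: (coord_inj (j := ratr) prime5 kapE (pint_W W5)).
by move=> x y; apply: inert5.
Qed.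

Lemma W5_nonsquare (r : rat) : W != r ^+ 2.
Proof.
by apply: (W_nonsquare prime5 (pint_W W5)) => x y; apply: inert5.
Qed.

Lemma quad_quadratic : quadratic_field (quad kap).
Proof.
have [L [j [i [k [_ _ _ _ quadP]]]]] := quad_abstract kapE.
split.
  split; first by apply/quadP; exists 1; rewrite rmorph1.
  split; [|split].
  - move=> x y /quadP[x' ->] /quadP[y' ->]; apply/quadP.
    by exists (x' - y'); rewrite rmorphB.
  - move=> x y /quadP[x' ->] /quadP[y' ->]; apply/quadP.
    by exists (x' * y'); rewrite rmorphM.
  - by move=> x /quadP[x' ->] _; apply/quadP; exists x'^-1; rewrite fmorphV.
exists 1, kap; split; first by apply/quadP; exists 1; rewrite rmorph1.
split; first by exists 0, 1; rewrite rmorph0 rmorph1 add0r mul1r.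
split=> [p q e|x [p [q ->]]]; last by exists p, q; rewrite mulr1.
by apply: quad_coord_inj; rewrite !rmorph0 mul0r addr0 -[RHS]e mulr1.
Qed.

Lemma quad_scale (r : rat) x : r != 0 -> quad kap x <-> quad (ratr r * kap) x.
Proof.
move=> r0; split=> [[p [q ->]]|[p [q ->]]].
  by exists p, (q / r); rewrite mulrA -rmorphM /= divfK.
by exists p, (q * r); rewrite mulrA -rmorphM.
Qed.

(** Squaring kappa' = a + b kappa gives 2 a b = 0: either W' = a^2, which is excluded, or W' = b^2
    W. *)
Lemma quad_sqrt (kap' : algC) (W' : rat) :
  kap' ^+ 2 = ratr W' -> (forall r, W' != r ^+ 2) -> quad kap kap' ->
  exists r, W * W' = r ^+ 2.
Proof.
move=> kapE' nsq [a [b e]].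
have : ratr W' + ratr 0 * kap = ratr (a ^+ 2 + b ^+ 2 * W) + ratr (2 * a * b) * kap.
  rewrite rmorph0 mul0r addr0 -kapE' e !expr2 !(rmorph_nat, rmorphD, rmorphM) /= -kapE.
  by ring.
case/quad_coord_inj => WE /esym/eqP; rewrite -mulrA !mulf_eq0 pnatr_eq0 /=.
case/orP=> /eqP z0; last by have := nsq a; rewrite WE z0 expr0n mul0r addr0 eqxx.
by exists (b * W); rewrite WE z0; ring.
Qed.

End QuadraticField.

(** The conic zeta^2 = 1 + W - W^2 parametrised by the lines W = n (zeta + 1) through its point (0,
    -1). *)
Definition base_W (n : nat) : rat := (n * (n + 2))%:R / (n ^ 2 + 1)%:R.
Definition base_zeta (n : nat) : rat := (1 + n%:R - n%:R ^+ 2) / (n ^ 2 + 1)%:R.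

Lemma base_den_neq0 n : (n ^ 2 + 1)%:R != 0 :> rat.
Proof. by rewrite pnatr_eq0 addn1. Qed.

Lemma unit_at_base p n e : prime p -> unit_at p e n%:R ->
  ~~ (p %| n + 2)%N -> ~~ (p %| n ^ 2 + 1)%N -> unit_at p e (base_W n).
Proof.
move=> pp un p2 p1; rewrite /base_W natrM -mulrA -[e]addn0.
apply: (unit_atM pp) => //; apply: (unit_atM pp (e := 0) (e' := 0)).
  by apply: (unit_at_int pp (n := (n + 2)%N)).
by apply/unit_at0V/(unit_at_int pp (n := (n ^ 2 + 1)%N)).
Qed.

(** n = 4 modulo 5 makes W and zeta congruent to 2. Since n + 2 and n^2 + 1 are prime to 3, W has
    the 3-adic valuation of n, which is at least 2. *)
Lemma good_base n : (0 < n)%N -> (n %% 5 = 4)%N -> (9 %| n)%N ->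
  exists2 e, (1 < e)%N & good e (base_W n) (base_zeta n).
Proof.
move=> n0 n5 /dvdnP[m' nE']; move: (n0); rewrite {1}nE' muln_gt0 andbT => m'0.
have [e' ue'] := unit_at_ex prime3 m'0; exists (e' + 2)%N; first by rewrite addn2.
have [m nE] : exists m, n = (5 * m + 4)%N.
  by exists (n %/ 5)%N; rewrite {1}(divn_eq n 5) n5 mulnC.
have D0 := base_den_neq0 n.
have DE : (n ^ 2 + 1)%:R = n%:R ^+ 2 + 1 :> rat by rewrite natrD natrX.
have nR : n%:R = 5 * m%:R + 4 :> rat by rewrite nE natrD natrM.
have V5 := pint_valuation_ring prime5.
have frac5 (x : rat) (k : int) :
    x = (5 * k)%:~R -> vdiv (pint 5) 5%:R 1 (x / (n ^ 2 + 1)%:R).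
  move=> ->; apply: (vdivMr V5); first by apply/(vdiv_int prime5); rewrite dvdz_mulr.
  apply: (pintV (p := 5) (n := (n ^ 2 + 1)%N)); rewrite dvdzE /=.
  have -> : (n ^ 2 + 1 = (5 * m ^ 2 + 8 * m + 3) * 5 + 2)%N by rewrite nE; ring.
  by rewrite dvdn_addr // dvdn_mull.
split.
- move: D0; rewrite /base_zeta /base_W natrM (natrD _ n 2) DE => D0; field; exact: D0.
- have -> : base_W n - 2 = - (n%:R ^+ 2 - 2 * n%:R + 2) / (n ^ 2 + 1)%:R.
    move: D0; rewrite /base_W natrM (natrD _ n 2) DE => D0; field; exact: D0.
  apply: (frac5 _ (- (5 * m%:Z ^+ 2 + 6 * m%:Z + 2))).
  by rewrite !(rmorphN, rmorphD, rmorphM, rmorphXn) /= nR -!pmulrn; ring.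
- have -> : base_zeta n - 2 = (n%:R - 1 - 3 * n%:R ^+ 2) / (n ^ 2 + 1)%:R.
    move: D0; rewrite /base_zeta DE => D0; field; exact: D0.
  apply: (frac5 _ (- (15 * m%:Z ^+ 2 + 23 * m%:Z + 9))).
  by rewrite !(rmorphN, rmorphD, rmorphM, rmorphXn) /= nR -!pmulrn; ring.
- apply: (unit_at_base prime3).
  + rewrite nE' natrM; apply: (unit_atM prime3) => //.
    by apply: (unit_atX prime3 2 (unit_at_p prime3)).
  + by rewrite nE' -[9%N]/(3 * 3)%N mulnA dvdn_addr // dvdn_mull.
  + by rewrite nE' -[9%N]/(3 * 3)%N mulnA expnMn dvdn_addr // dvdn_mull.
Qed.

Section Triples.
Variables (W0 zeta0 : rat) (e0 : nat) (kap : algC).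
Hypotheses (g0 : good e0 W0 zeta0) (e0_gt1 : (1 < e0)%N) (kapE : kap ^+ 2 = ratr W0).

(* Tripling on zeta^2 = 1 + W - W^2 twisted by kappa; the state (r, zeta)
   stands for kappa r and W = W0 r^2. *)
Definition trip_step (s : rat * rat) : rat * rat :=
  let W := W0 * s.1 ^+ 2 in (s.1 * rho W, s.2 * zfac W).

Definition trip m : rat * rat := iter m trip_step (1, zeta0).
Definition trip_W m : rat := W0 * (trip m).1 ^+ 2.

Lemma good_trip m : good (e0 + 2 * m) (trip_W m) (trip m).2.
Proof.
elim: m => [|m IHm]; first by rewrite /trip_W muln0 addn0 /= expr1n mulr1.
have e_gt1 : (1 < e0 + 2 * m)%N by apply: leq_trans e0_gt1 (leq_addr _ _).
have := good_step IHm e_gt1; rewrite mulnS [(2 + _)%N]addnC addnA addn2.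
suff -> : trip_W m.+1 = trip_W m * rho (trip_W m) ^+ 2 by [].
rewrite /trip_W [trip m.+1]/(trip_step (trip m)) /trip_step /=.
by move: (rho _) => r; ring.
Qed.

Lemma trip_neq0 m : (trip m).1 != 0.
Proof.
have [+ _ _] := good_W3 (good_trip m); rewrite /trip_W mulf_eq0 sqrf_eq0.
by rewrite negb_or => /andP[].
Qed.

(** The rational number here is the square of the first element of the triple; its 3-adic valuation
    grows with e and so tells the triples apart. *)
Lemma coef_a_unit e W zeta : good e W zeta -> (1 < e)%N ->
  unit_at 3 (e * 3) (coef_a W ^+ 2 * W).
Proof.
move=> gW e1; have uW := good_W3 gW.
have V3 := pint_valuation_ring prime3.
have vW : vdiv (pint 3) 3%:R 1 W.
  by have [_ vW _] := uW; apply: (vdiv_le V3 _ vW); apply: ltnW.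
have uD : unit_at 3 0 ((1 - W ^+ 2)^-1 ^+ 2).
  apply: (unit_atX prime3 2 (e := 0)); apply: unit_at0V; apply: (unit_at_sub1 prime3).
  by apply: (vdiv_le V3 _ (vdivX V3 2 vW)).
have u4 : unit_at 3 0 4 by apply: (unit_at_int prime3 (n := 4)).
have -> : coef_a W ^+ 2 * W = 4 * (W ^+ 3 * (1 - W ^+ 2)^-1 ^+ 2).
  by rewrite /coef_a; move: (1 - W ^+ 2)^-1 => d; ring.
rewrite -[(e * 3)%N]addn0 -[(_ + 0)%N]add0n; apply: (unit_atM prime3) => //.
by apply: (unit_atM prime3) => //; apply: (unit_atX prime3).
Qed.

Definition trip_triple m : algC * algC * algC :=
  triple_of (ratr (trip m).1 * kap) (trip_W m) (trip m).2.

Let kap_m m : (ratr (trip m).1 * kap) ^+ 2 = ratr (trip_W m).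
Proof. by rewrite exprMn kapE /trip_W mulrC rmorphM rmorphXn. Qed.

Lemma trip_triple_inj : injective trip_triple.
Proof.
move=> m m' [e _ _]; have e_gt1 k : (1 < e0 + 2 * k)%N.
  exact: leq_trans e0_gt1 (leq_addr _ _).
have {}e : coef_a (trip_W m) ^+ 2 * trip_W m = coef_a (trip_W m') ^+ 2 * trip_W m'.
  apply: (fmorph_inj (ratr : {rmorphism rat -> algC})).
  have ratrXM x y : ratr (x ^+ 2 * y) = ratr x ^+ 2 * ratr y :> algC.
    by rewrite rmorphM rmorphXn.
  rewrite /= (ratrXM (coef_a _)) (ratrXM (coef_a (trip_W m'))).
  by rewrite -(kap_m m) -(kap_m m') -!exprMn e.
have u := coef_a_unit (good_trip m) (e_gt1 m).
have u' := coef_a_unit (good_trip m') (e_gt1 m').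
rewrite e in u; have := unit_at_inj prime3 u u'.
by move/eqP; rewrite eqn_pmul2r // eqn_add2l eqn_pmul2l // => /eqP.
Qed.

Lemma trip_triple_torsion m : let: (a, b, c) := trip_triple m in
  dioph_triple (quad kap) a b c /\ torsion_Z2xZ10 (quad kap) a b c.
Proof.
apply: (triple_of_torsion (W := trip_W m)).
- by move=> x; apply: quad_scale; apply: trip_neq0.
- exact: kap_m.
- exact: good_curve (good_trip m).
- exact: good_W5 (good_trip m).
- exact: good_zeta5 (good_trip m).
Qed.

End Triples.

(* For a prime q > 5 this is a multiple of 9 congruent to 4 modulo 5, and
   exactly divisible by q. *)
Definition base_n (q : nat) : nat := 9 * (q * (q ^ 3 %% 5)).

(** With n = [base_n (base_q i')], the bound exceeds n, n + 2 and n^2 + 1, so the next prime divides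
    neither the numerator nor the denominator of the earlier [base_W n]. *)
Fixpoint base_q (i : nat) : nat :=
  if i is i'.+1 then sval (prime_above (base_n (base_q i') ^ 2 + base_n (base_q i') + 2))
  else 7.

(** By Fermat q^4 = 1 modulo 5, and 9 = 4 modulo 5. *)
Lemma base_n_mod5 q : prime q -> (5 < q)%N ->
  (0 < q ^ 3 %% 5)%N /\ (base_n q %% 5 = 4)%N.
Proof.
move=> pq q5; have q0 : (0 < q %% 5)%N.
  by rewrite lt0n; apply: contraL q5 => /eqP/eqP; rewrite -/(5 %| q)%N dvdn_prime2 // => /eqP<-.
have -> : (base_n q %% 5 = 9 * ((q %% 5) * (q ^ 3 %% 5)) %% 5)%N.
  by rewrite /base_n -modnMmr -[in RHS]modnMmr modnMml.
rewrite -modnXm; move: (ltn_pmod q (isT : 0 < 5)%N) q0.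
by case: (q %% 5)%N => [|[|[|[|[|]]]]].
Qed.

Lemma leq_base_n q : prime q -> (5 < q)%N -> (q <= base_n q)%N.
Proof.
move=> pq q5; have [u0 _] := base_n_mod5 pq q5.
by rewrite /base_n mulnCA leq_pmulr // muln_gt0.
Qed.

Lemma base_q_step i :
  (base_n (base_q i) ^ 2 + base_n (base_q i) + 2 < base_q i.+1)%N.
Proof. by rewrite /=; case: prime_above. Qed.

Lemma base_q_prime i : prime (base_q i) /\ (5 < base_q i)%N.
Proof.
elim: i => [|i [pq q5]]; first by [].
split; first by rewrite /=; case: prime_above.
have := leq_base_n pq q5; have := base_q_step i; lia.
Qed.

Lemma base_q_lt i j : (i < j)%N ->
  (base_n (base_q i) ^ 2 + base_n (base_q i) + 2 < base_q j)%N.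
Proof.
elim: j => // j IHj; rewrite ltnS leq_eqVlt => /predU1P[->|/IHj lt]; first exact: base_q_step.
have [pq q5] := base_q_prime j.
have := leq_base_n pq q5; have := base_q_step j; lia.
Qed.

Lemma base_n_gt0 i : (0 < base_n (base_q i))%N.
Proof. by have [pq q5] := base_q_prime i; have := leq_base_n pq q5; lia. Qed.

Lemma unit_at_base_self i : unit_at (base_q i) 1 (base_W (base_n (base_q i))).
Proof.
have [pq q5] := base_q_prime i; have [u0 _] := base_n_mod5 pq q5.
have qn : (base_q i %| base_n (base_q i))%N by rewrite /base_n mulnCA dvdn_mulr.
apply: unit_at_base => //.
- rewrite /base_n mulnCA natrM; apply: (unit_atM pq (e := 1) (e' := 0)).
    exact: unit_at_p.
  apply: (unit_at_int pq (n := (9 * (base_q i ^ 3 %% 5))%N)).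
  rewrite dvdzE /= Euclid_dvdM // negb_or; apply/andP; split.
    rewrite -[9%N]/(3 ^ 2)%N Euclid_dvdX // andbT dvdn_prime2 //.
    by apply: contraTneq q5 => ->.
  by rewrite gtnNdvd // (leq_trans (ltn_pmod _ _)) // ltnW.
- by rewrite dvdn_addr // gtnNdvd //; lia.
- by rewrite dvdn_addr ?dvdn_exp // gtnNdvd //; lia.
Qed.

Lemma unit_at_base_lt i j : (i < j)%N ->
  unit_at (base_q j) 0 (base_W (base_n (base_q i))).
Proof.
move=> /base_q_lt lt; have [pq q5] := base_q_prime j.
have n0 := base_n_gt0 i.
move: lt n0; set n := base_n (base_q i) => lt n0.
have n2 : (0 <= n ^ 2)%N by [].
apply: unit_at_base => //.
- by apply: (unit_at_int pq (n := n)); rewrite dvdzE /= gtnNdvd //; lia.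
- by rewrite gtnNdvd //; lia.
- by rewrite gtnNdvd //; lia.
Qed.

Definition base_field (i : nat) : algC -> Prop :=
  quad (sqrtC (ratr (base_W (base_n (base_q i))))).

Lemma good_base_q i : exists2 e, (1 < e)%N &
  good e (base_W (base_n (base_q i))) (base_zeta (base_n (base_q i))).
Proof.
have [pq q5] := base_q_prime i; have [_ n5] := base_n_mod5 pq q5.
by apply: good_base => //; [exact: base_n_gt0|rewrite dvdn_mulr].
Qed.

(** Equal fields would make the product of the two values of W a rational square, but at the prime
    [base_q j] that product has valuation 0 + 1. *)
Lemma base_field_neq i j : (i < j)%N -> base_field i <> base_field j.
Proof.
move=> ij eqK; have [e _ gi] := good_base_q i; have [e' _ gj] := good_base_q j.
have : base_field i (sqrtC (ratr (base_W (base_n (base_q j))))).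
  by rewrite eqK; exists 0, 1; rewrite rmorph0 rmorph1 add0r mul1r.
case/(quad_sqrt (sqrtCK _) (good_W5 gi) (sqrtCK _) (W5_nonsquare (good_W5 gj))) => r.
have [pq _] := base_q_prime j.
have := unit_atM pq (unit_at_base_lt ij) (unit_at_base_self j).
by rewrite add0n => u rE; apply: (unit_at_nonsquare pq (r := r)); rewrite -rE.
Qed.

Lemma base_field_inj : injective base_field.
Proof.
move=> i j e; have [/base_field_neq //|/base_field_neq nji|//] := ltngtP i j.
by case: nji.
Qed.

Local Close Scope ring_scope.

Theorem theorem1 :
  exists Ks : nat -> (algC -> Prop),
    injective Ks /\
    forall n, quadratic_field (Ks n) /\
      exists T : nat -> algC * algC * algC,
        injective T /\
        forall m, let: (a, b, c) := T m in
          dioph_triple (Ks n) a b c /\ torsion_Z2xZ10 (Ks n) a b c.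
Proof.
exists base_field; split; first exact: base_field_inj.
move=> n; have [e e1 gn] := good_base_q n; split.
  exact: quad_quadratic (sqrtCK _) (good_W5 gn).
exists (trip_triple (base_W (base_n (base_q n))) (base_zeta (base_n (base_q n)))
  (sqrtC (ratr (base_W (base_n (base_q n)))))); split.
  exact: (trip_triple_inj gn e1 (sqrtCK _)).
by move=> m; apply: (trip_triple_torsion gn e1 (sqrtCK _)).
Qed.
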